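(* Let $0\le\lambda\le 1$, $0\le\alpha<1$ and $t\in(0,1)$, and suppose that $$t\neq\frac{(1+\lambda)\Psi_2(\alpha)}{2\sqrt{(\lambda^2+5\lambda+2)\Psi_2^2(\alpha)-2(1+2\lambda)\Psi_3(\alpha)}}$$ (this condition being void when the quantity under the square root is not positive). Let $f(z)=z+\sum_{n=2}^\infty a_n z^n$ be in the class $\mathcal{R}_\Sigma(\lambda,\alpha,\Phi(z,t))$. Then $$|a_2|\le\frac{2t\sqrt{2t}}{\sqrt{\left|[2(1+2\lambda)\Psi_3(\alpha)-(\lambda^2+5\lambda+2)\Psi_2^2(\alpha)]\,4t^2+(1+\lambda)^2\Psi_2^2(\alpha)\right|}}$$ and $$|a_3|\le\frac{4t^2}{(1+\lambda)^2\Psi_2^2(\alpha)}+\frac{t}{(1+2\lambda)\Psi_3(\alpha)}.$$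
   Context: Let $\triangle=\{z\in\mathbb{C}:|z|<1\}$. Let $\mathcal{A}$ be the class of analytic functions on $\triangle$ of the form $f(z)=z+\sum_{n\ge2}a_nz^n$. A function $f\in\mathcal{A}$ is bi-univalent if both $f$ and $f^{-1}$ are univalent in $\triangle$ (i.e. $f$ is univalent in $\triangle$ and the inverse $f^{-1}$, defined near $0$, extends to a univalent analytic function on $\triangle$); $\Sigma$ is the class of bi-univalent functions. For $f\in\Sigma$ write $g=f^{-1}$, so $g(w)=w-a_2w^2+(2a_2^2-a_3)w^3+\cdots$. For analytic $p,q$ on $\triangle$, $p\prec q$ ($p$ is subordinate to $q$) means there is an analytic $\omega$ on $\triangle$ with $\omega(0)=0$, $|\omega(z)|<1$ and $p(z)=q(\omega(z))$. For $0\le\alpha<1$ let $s(z)=\dfrac{z}{(1-z)^{2(1-\alpha)}}=z+\sum_{n\ge2}\Psi_n(\alpha)z^n$, where $\Psi_n(\alpha)=\dfrac{\prod_{k=2}^n(k-2\alpha)}{(n-1)!}$; thus $\Psi_2(\alpha)=2-2\alpha$ and $\Psi_3(\alpha)=\frac{(2-2\alpha)(3-2\alpha)}{2}$. $\Psi_n^2(\alpha)$ means $(\Psi_n(\alpha))^2$. Let $*$ denote the Hadamard (coefficientwise) product of power series, and put $F=s*f$, $G=s*g$, so $F(z)=z+\Psi_2(\alpha)a_2z^2+\Psi_3(\alpha)a_3z^3+\cdots$ and $G(w)=w-\Psi_2(\alpha)a_2w^2+\Psi_3(\alpha)(2a_2^2-a_3)w^3+\cdots$. Let $\Phi(z,t)=\dfrac{1}{1-2tz+z^2}$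 for $z\in\triangle$. For $0\le\lambda\le1$, $0\le\alpha<1$ and $t\in(0,1)$, the class $\mathcal{R}_\Sigma(\lambda,\alpha,\Phi(z,t))$ consists of all $f\in\Sigma$ such that, for $z,w\in\triangle$, $$(1-\lambda)\frac{zF'(z)}{F(z)}+\lambda\left(1+\frac{zF''(z)}{F'(z)}\right)\prec\Phi(z,t)\quad\text{and}\quad(1-\lambda)\frac{wG'(w)}{G(w)}+\lambda\left(1+\frac{wG''(w)}{G'(w)}\right)\prec\Phi(w,t).$$ *)

(* Defs.v *)
From Stdlib Require Import Reals List Factorial.
From Coquelicot Require Import Coquelicot.

Open Scope R_scope.

Definition in_disk (z : C) : Prop := Cmod z < 1.

Definition analytic_at (f : C -> C) (z0 : C) : Prop :=
  exists (r : R) (a : nat -> C), 0 < r /\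
    forall z : C, Cmod (z - z0)%C < r ->
      @is_pseries C_AbsRing C_NormedModule a (z - z0)%C (f z).

(* Functions on the disk are represented by total functions [C -> C] whose
   values outside the disk are irrelevant. *)
Definition analytic_on_disk (f : C -> C) : Prop :=
  forall z0 : C, in_disk z0 -> analytic_at f z0.

Definition has_expansion (f : C -> C) (a : nat -> C) : Prop :=
  forall z : C, in_disk z -> @is_pseries C_AbsRing C_NormedModule a z (f z).

(* f(z) = z + a_2 z^2 + a_3 z^3 + ... *)
Definition normalized_expansion (f : C -> C) (a : nat -> C) : Prop :=
  a 0%nat = RtoC 0 /\ a 1%nat = RtoC 1 /\ has_expansion f a.

Definition class_A (f : C -> C) : Prop :=
  analytic_on_disk f /\ exists a : nat -> C, normalized_expansion f a.

Definition univalent (f : C -> C) : Prop :=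
  analytic_on_disk f /\
  forall z1 z2 : C, in_disk z1 -> in_disk z2 -> f z1 = f z2 -> z1 = z2.

(* For f injective on the disk, the last clause says that g agrees near 0 with
   the inverse of f : disk -> f(disk). *)
Definition univalent_inverse (f g : C -> C) : Prop :=
  univalent g /\
  exists r : R, 0 < r /\
    forall w : C, Cmod w < r -> in_disk (g w) /\ f (g w) = w.

Definition bi_univalent (f : C -> C) : Prop :=
  class_A f /\ univalent f /\ exists g : C -> C, univalent_inverse f g.

Definition subordinate (p q : C -> C) : Prop :=
  analytic_on_disk p /\ analytic_on_disk q /\
  exists omega : C -> C,
    analytic_on_disk omega /\ omega (RtoC 0) = RtoC 0 /\
    (forall z : C, in_disk z -> Cmod (omega z) < 1) /\
    (forall z : C, in_disk z -> p z = q (omega z)).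

(* Principal argument and principal real power, for w not in (-oo, 0]. *)
Definition Carg (w : C) : R := 2 * atan (Im w / (Cmod w + Re w)).

Definition Crpower (w : C) (b : R) : C :=
  (RtoC (Rpower (Cmod w) b) * (cos (b * Carg w), sin (b * Carg w)))%C.

Definition s_fun (alpha : R) (z : C) : C :=
  (z / Crpower (1 - z) (2 * (1 - alpha)))%C.

(* \prod_{k=2}^n (k - 2 alpha) / (n-1)! , for n >= 1 *)
Definition Psi (n : nat) (alpha : R) : R :=
  fold_right Rmult 1 (map (fun k => INR k - 2 * alpha) (seq 2 (n - 1)))
  / INR (fact (n - 1)).

(* h is the Hadamard product of p and q. *)
Definition hadamard (p q h : C -> C) : Prop :=
  exists a b : nat -> C,
    has_expansion p a /\ has_expansion q b /\
    has_expansion h (fun n => (a n * b n)%C).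

Definition Phi (t : R) (z : C) : C := (1 / (1 - 2 * t * z + z ^ 2))%C.

Definition class_expr (lambda : R) (F : C -> C) (z : C) : C :=
  ((1 - lambda) * (z * C_derive F z / F z)
   + lambda * (1 + z * C_derive (C_derive F) z / C_derive F z))%C.

(* The quotient zF'/F is 0/0 at z = 0, so the left-hand side of the
   subordination is the analytic function on the disk which coincides with
   [class_expr lambda F] wherever no denominator vanishes; as F(z) = z + ...,
   the exceptional points are isolated and this function is unique. *)
Definition class_expr_subordinate (lambda t : R) (F : C -> C) : Prop :=
  exists p : C -> C,
    (forall z : C, in_disk z -> z <> RtoC 0 ->
       F z <> RtoC 0 -> C_derive F z <> RtoC 0 ->
       p z = class_expr lambda F z) /\
    subordinate p (Phi t).

Definition R_Sigma (lambda alpha t : R) (f : C -> C) : Prop :=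
  bi_univalent f /\
  exists g F G : C -> C,
    univalent_inverse f g /\
    hadamard (s_fun alpha) f F /\ hadamard (s_fun alpha) g G /\
    class_expr_subordinate lambda t F /\ class_expr_subordinate lambda t G.

(* Main.v *)
Require Import Defs.
From Stdlib Require Import Reals Lra Classical ClassicalEpsilon.
From Coquelicot Require Import Coquelicot.
Open Scope R_scope.

(** Write the two subordinations as [class_expr F = Phi (w z)] and
    [class_expr G = Phi (v z)] with Schwarz functions
    [w = c1 z + c2 z^2 + ...] and [v = d1 z + d2 z^2 + ...].  The coefficients
    of [G] are known from those of [F], because [f (g w) = w] determines the
    first coefficients of [g].  Comparing the coefficients of [z] and [z^2]
    yields, with [P2 = Psi 2 alpha] and [P3 = Psi 3 alpha], the four equations
    - [(1 + lambda) P2 a2 = 2 t c1],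
    - [2 (1 + 2 lambda) P3 a3 - (1 + 3 lambda) P2^2 a2^2
         = 2 t c2 + (4 t^2 - 1) c1^2],
    - [- (1 + lambda) P2 a2 = 2 t d1],
    - [2 (1 + 2 lambda) P3 (2 a2^2 - a3) - (1 + 3 lambda) P2^2 a2^2
         = 2 t d2 + (4 t^2 - 1) d1^2].

    Hence [d1 = - c1].  Adding the two quadratic equations eliminates [a3] and
    gives [D a2^2 = 4 t^3 (c2 + d2)], where [D] is the expression under the
    absolute value in the bound on [a2]; subtracting them gives
    [2 (1 + 2 lambda) P3 (a3 - a2^2) = t (c2 - d2)]
    ([coefficient_identities]).  The bounds follow from [|c1|, |c2|, |d2| <= 1],
    the excluded value of [t] being the one for which [D = 0].

    Coefficients are compared through expansions
    [f z = a + b z + c z^2 + O(z^3)] near [0] (predicate [jet]): they can be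
    added, multiplied, divided and composed, a power series has one
    ([Cpseries_jet]), and they are unique, even when only positive real [z] are
    looked at ([jet_unique_real]).  The last point gives the coefficients of
    [s_fun] from the real Taylor formula for [(1 - x)^(-b)]
    ([s_fun_coefficients]).  The derivatives in [class_expr] are handled by
    termwise differentiation of complex power series
    ([has_expansion_C_derive]).

    The bounds on the coefficients of a Schwarz function [w]
    ([schwarz_coefficients]) come from the maximum principle applied to [w z / z]
    and, for [c2], to [e z / z^2], where [e z = (w z + w (- z)) / 2] is again
    bounded by [1] and begins with [c2 z^2].  The maximum principle
    ([max_modulus]) needs only second-order expansions at each point:
    [|h|^2 + eps |z|^2] has positive Laplacian, hence no interior maximum, and
    the Laplacian is replaced by the sum over the four points [z +- x],
    [z +- i x]. *)

(** * Second-order expansions at the origin *)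

(** The point [0] itself is left out: quotients such as [f z / z] and
    [z F'(z) / F(z)] have no meaningful value there. *)
Definition near0 (P : C -> Prop) : Prop :=
  exists r : R, 0 < r /\ forall z : C, z <> RtoC 0 -> Cmod z < r -> P z.

Lemma near0_and (P Q : C -> Prop) :
  near0 P -> near0 Q -> near0 (fun z => P z /\ Q z).
Proof.
  intros [r [Hr HP]] [s [Hs HQ]].
  exists (Rmin r s); split; [apply Rmin_glb_lt; assumption|].
  intros z Hz Hlt.
  pose proof (Rmin_l r s); pose proof (Rmin_r r s).
  split; [apply HP|apply HQ]; try assumption; lra.
Qed.

Lemma near0_imp (P Q : C -> Prop) :
  (forall z, z <> RtoC 0 -> P z -> Q z) -> near0 P -> near0 Q.
Proof. intros H [r [Hr HP]]; exists r; split; [assumption|]; auto. Qed.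

Lemma near0_small (e : R) : 0 < e -> near0 (fun z => Cmod z < e).
Proof. intros He; exists e; auto. Qed.

Definition bounded0 (f : C -> C) : Prop :=
  exists M : R, near0 (fun z => Cmod (f z) <= M).

Lemma bounded0_const (c : C) : bounded0 (fun _ => c).
Proof. exists (Cmod c), 1; split; [lra|intros; apply Rle_refl]. Qed.

Lemma bounded0_id : bounded0 (fun z => z).
Proof. exists 1, 1; split; [lra|intros; lra]. Qed.

Lemma bounded0_plus (f g : C -> C) :
  bounded0 f -> bounded0 g -> bounded0 (fun z => f z + g z)%C.
Proof.
  intros [M HM] [N HN]; exists (M + N).
  refine (near0_imp _ _ _ (near0_and _ _ HM HN)).
  intros z _ [A B]; eapply Rle_trans; [apply Cmod_triangle|lra].
Qed.

Lemma bounded0_mult (f g : C -> C) :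
  bounded0 f -> bounded0 g -> bounded0 (fun z => f z * g z)%C.
Proof.
  intros [M HM] [N HN]; exists (M * N).
  refine (near0_imp _ _ _ (near0_and _ _ HM HN)).
  intros z _ [A B]; rewrite Cmod_mult.
  apply Rmult_le_compat; auto using Cmod_ge_0.
Qed.

#[local] Hint Resolve bounded0_const bounded0_id bounded0_plus bounded0_mult : bdd.

(** The remainder is kept as an explicit factor of [z^3], so that the algebra of
    expansions reduces to ring identities and boundedness of the factor. *)
Definition jet (f : C -> C) (a b c : C) : Prop :=
  exists q : C -> C, bounded0 q /\
    near0 (fun z => f z = a + b * z + c * (z * z) + z * z * z * q z)%C.

Lemma jet_ext (f g : C -> C) (a b c : C) :
  near0 (fun z => f z = g z) -> jet f a b c -> jet g a b c.
Proof.
  intros He [q [Hq Hf]]; exists q; split; [assumption|].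
  refine (near0_imp _ _ _ (near0_and _ _ He Hf)).
  intros z _ [E L]; now rewrite <- E.
Qed.

Lemma jet_eq (f : C -> C) (a b c a' b' c' : C) :
  a = a' -> b = b' -> c = c' -> jet f a b c -> jet f a' b' c'.
Proof. intros; subst; assumption. Qed.

Lemma jet_const (k : C) : jet (fun _ => k) k (RtoC 0) (RtoC 0).
Proof.
  exists (fun _ => RtoC 0); split; [auto with bdd|].
  exists 1; split; [lra|]; intros; ring.
Qed.

Lemma jet_id : jet (fun z => z) (RtoC 0) (RtoC 1) (RtoC 0).
Proof.
  exists (fun _ => RtoC 0); split; [auto with bdd|].
  exists 1; split; [lra|]; intros; ring.
Qed.

Lemma jet_plus (f g : C -> C) (a b c a' b' c' : C) :
  jet f a b c -> jet g a' b' c' ->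
  jet (fun z => f z + g z)%C (a + a') (b + b') (c + c').
Proof.
  intros [q [Hq Hf]] [q' [Hq' Hg]].
  exists (fun z => q z + q' z)%C; split; [auto with bdd|].
  refine (near0_imp _ _ _ (near0_and _ _ Hf Hg)).
  intros z _ [E E']; rewrite E, E'; ring.
Qed.

Lemma jet_mult (f g : C -> C) (a b c a' b' c' : C) :
  jet f a b c -> jet g a' b' c' ->
  jet (fun z => f z * g z)%C
    (a * a') (a * b' + b * a') (a * c' + b * b' + c * a').
Proof.
  intros [q [Hq Hf]] [q' [Hq' Hg]].
  exists (fun z => (b * c' + c * b' + z * (c * c'))
     + (q z * (a' + b' * z + c' * (z * z)) + q' z * (a + b * z + c * (z * z)))
     + z * z * z * (q z * q' z))%C; split; [auto 20 with bdd|].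
  refine (near0_imp _ _ _ (near0_and _ _ Hf Hg)).
  intros z _ [E E']; rewrite E, E'; ring.
Qed.

Lemma near0_mult_small (q : C -> C) (e : R) :
  bounded0 q -> 0 < e -> near0 (fun z => Cmod (z * q z)%C < e).
Proof.
  intros [M HM] He.
  pose proof (Rabs_pos M) as HM0.
  assert (Hd : 0 < e / (Rabs M + 1)) by (apply Rdiv_lt_0_compat; lra).
  refine (near0_imp _ _ _ (near0_and _ _ HM (near0_small _ Hd))).
  intros z Hz [A B]; rewrite Cmod_mult.
  pose proof (Rle_abs M).
  apply Rle_lt_trans with (Cmod z * (Rabs M + 1)).
  - apply Rmult_le_compat_l; [apply Cmod_ge_0|lra].
  - apply Rmult_lt_compat_r with (r := Rabs M + 1) in B; [|lra].
    unfold Rdiv in B; rewrite Rmult_assoc, Rinv_l in B by lra; lra.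
Qed.

Lemma jet_tail (f : C -> C) (a b c : C) :
  jet f a b c ->
  exists k, bounded0 k /\ near0 (fun z => f z = a + z * k z)%C.
Proof.
  intros [q [Hq Hf]].
  exists (fun z => b + c * z + z * z * q z)%C; split; [auto 10 with bdd|].
  revert Hf; apply near0_imp; intros z _ E; rewrite E; ring.
Qed.

Lemma jet_lower_bound (f : C -> C) (a b c : C) :
  a <> RtoC 0 -> jet f a b c -> near0 (fun z => Cmod a / 2 <= Cmod (f z)).
Proof.
  intros Ha Hf.
  destruct (jet_tail _ _ _ _ Hf) as [k [Hk Hfk]].
  apply Cmod_gt_0 in Ha.
  assert (Ha2 : 0 < Cmod a / 2) by lra.
  refine (near0_imp _ _ _ (near0_and _ _ Hfk (near0_mult_small _ _ Hk Ha2))).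
  intros z _ [E L]; rewrite E.
  pose proof (Cmod_triangle (a + z * k z) (- (z * k z))) as T.
  rewrite Cmod_opp in T.
  replace (a + z * k z + - (z * k z))%C with a in T by ring.
  lra.
Qed.

Lemma jet_neq_0 (f : C -> C) (a b c : C) :
  a <> RtoC 0 -> jet f a b c -> near0 (fun z => f z <> RtoC 0).
Proof.
  intros Ha Hf; generalize (jet_lower_bound _ _ _ _ Ha Hf).
  apply near0_imp; intros z _ L.
  apply Cmod_gt_0 in Ha; apply Cmod_gt_0; lra.
Qed.

(** The claimed expansion [P] of [1 / f] satisfies [f P = 1 + z^3 q], so that
    [1 / f - P = - z^3 q / f], and [f] stays away from [0]. *)
Lemma jet_inv (f : C -> C) (a b c : C) :
  a <> RtoC 0 -> jet f a b c ->
  jet (fun z => / f z)%C (/ a) (- b / (a * a)) ((b * b - a * c) / (a * a * a)).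
Proof.
  intros Ha Hf.
  set (A := (/ a)%C); set (B := (- b / (a * a))%C);
  set (D := ((b * b - a * c) / (a * a * a))%C).
  assert (HP : jet (fun z => A + B * z + D * (z * z))%C A B D).
  { exists (fun _ => RtoC 0); split; [auto with bdd|].
    exists 1; split; [lra|]; intros; ring. }
  destruct (jet_mult _ _ _ _ _ _ _ _ Hf HP) as [q [Hq E]].
  exists (fun z => - (1) * q z * / f z)%C; split.
  - apply bounded0_mult; [auto with bdd|].
    exists (/ (Cmod a / 2)).
    refine (near0_imp _ _ _ (near0_and _ _ (jet_neq_0 _ _ _ _ Ha Hf)
                               (jet_lower_bound _ _ _ _ Ha Hf))).
    intros z _ [N L]; rewrite Cmod_inv by assumption.
    apply Cmod_gt_0 in Ha.
    apply Rinv_le_contravar; lra.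
  - refine (near0_imp _ _ _ (near0_and _ _ (jet_neq_0 _ _ _ _ Ha Hf) E)).
    intros z _ [N Ez].
    replace (a * A)%C with (RtoC 1) in Ez by (unfold A; field; assumption).
    replace (a * B + b * A)%C with (RtoC 0) in Ez
      by (unfold A, B; field; assumption).
    replace (a * D + b * B + c * A)%C with (RtoC 0) in Ez
      by (unfold A, B, D; field; assumption).
    transitivity ((A + B * z + D * (z * z))
       + (1 - f z * (A + B * z + D * (z * z))) * / f z)%C.
    + field; assumption.
    + rewrite Ez; ring.
Qed.

Lemma jet_div (f g : C -> C) (a b c a' b' c' : C) :
  a' <> RtoC 0 -> jet f a b c -> jet g a' b' c' ->
  jet (fun z => f z / g z)%C (a / a') ((b - a * b' / a') / a')
    ((c - b * b' / a' + a * (b' * b' - a' * c') / (a' * a')) / a').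
Proof.
  intros Ha Hf Hg.
  generalize (jet_mult _ _ _ _ _ _ _ _ Hf (jet_inv _ _ _ _ Ha Hg)).
  apply jet_eq; field; assumption.
Qed.

Lemma near0_comp (g : C -> C) (p q : C) (P : C -> Prop) :
  jet g (RtoC 0) p q -> near0 (fun z => g z <> RtoC 0) ->
  near0 P -> near0 (fun z => P (g z)).
Proof.
  intros Hg Hn [r [Hr HP]].
  destruct (jet_tail _ _ _ _ Hg) as [k [Hk E]].
  generalize (near0_and _ _ (near0_and _ _ E Hn) (near0_mult_small _ _ Hk Hr)).
  apply near0_imp; intros z _ [[Ez N] L].
  apply HP; [assumption|].
  rewrite Ez; now rewrite Cplus_0_l.
Qed.

Lemma jet_comp (f g : C -> C) (a b c p q : C) :
  jet f a b c -> jet g (RtoC 0) p q -> near0 (fun z => g z <> RtoC 0) ->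
  jet (fun z => f (g z)) a (b * p) (b * q + c * (p * p)).
Proof.
  intros [Q [[M HM] HQ]] Hg Hn.
  destruct Hg as [r [Hr Er]].
  assert (Hg : jet g (RtoC 0) p q) by (exists r; auto).
  exists (fun z => b * r z
    + c * (p * (q + z * r z) * (1 + 1) + z * ((q + z * r z) * (q + z * r z)))
    + (p + z * (q + z * r z)) * (p + z * (q + z * r z))
      * (p + z * (q + z * r z)) * Q (g z))%C; split.
  - assert (bounded0 (fun z => Q (g z))).
    { exists M; exact (near0_comp _ _ _ _ Hg Hn HM). }
    auto 30 with bdd.
  - generalize (near0_and _ _ Er (near0_comp _ _ _ _ Hg Hn HQ)).
    apply near0_imp; intros z _ [Ez EQ].
    rewrite EQ; generalize (Q (g z)); intros Qz.
    rewrite Ez; ring.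
Qed.

(** The hypothesis on positive reals only is what allows [f] to be compared with
    a function whose expansion comes from real analysis. *)
Lemma jet_unique_real (f : C -> C) (a b c a' b' c' : C) (r M : R) :
  jet f a b c -> 0 < r ->
  (forall x : R, 0 < x < r ->
     Cmod (f x - (a' + b' * x + c' * (x * x)))%C <= M * x ^ 3) ->
  a = a' /\ b = b' /\ c = c'.
Proof.
  intros [q [[N HN] E]] Hr HM.
  destruct (near0_and _ _ HN E) as [s [Hs H]]; clear HN E.
  assert (Hd : forall x : R, 0 < x < Rmin r s ->
     Cmod ((a - a') + x * ((b - b') + x * (c - c')))%C <= (M + N) * x ^ 3).
  { intros x [Hx0 Hx].
    pose proof (Rmin_l r s); pose proof (Rmin_r r s).
    specialize (HM x ltac:(lra)).
    destruct (H (RtoC x)) as [HN E].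
    - intros Hc; apply RtoC_inj in Hc; lra.
    - rewrite Cmod_R, Rabs_pos_eq; lra.
    - rewrite E in HM.
      replace ((a - a') + x * ((b - b') + x * (c - c')))%C with
        ((a + b * x + c * (x * x) + x * x * x * q x
          - (a' + b' * x + c' * (x * x))) + - (x * x * x * q x))%C by ring.
      eapply Rle_trans; [apply Cmod_triangle|].
      rewrite Cmod_opp, !Cmod_mult, Cmod_R, Rabs_pos_eq by lra.
      assert (0 < x * x * x) by (repeat apply Rmult_lt_0_compat; lra).
      replace ((M + N) * x ^ 3) with (M * x ^ 3 + x * x * x * N) by ring.
      apply Rplus_le_compat; [assumption|].
      apply Rmult_le_compat_l; lra. }
  assert (Hm : 0 < Rmin r s) by (apply Rmin_glb_lt; lra).
  clear - Hd Hm.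
  assert (Z : forall (d e : C) (K m : R), 0 < m ->
     (forall x : R, 0 < x < m -> Cmod (d + x * e)%C <= K * x) -> d = RtoC 0).
  { intros d e K m Hmm HK.
    apply NNPP; intros Hd0; apply Cmod_gt_0 in Hd0.
    pose proof (Rabs_pos K); pose proof (Cmod_ge_0 e); pose proof (Rle_abs K).
    set (x := Rmin (m / 2) (Cmod d / (2 * (Rabs K + Cmod e + 1)))).
    assert (Hx : 0 < x).
    { apply Rmin_glb_lt; [lra|apply Rdiv_lt_0_compat; lra]. }
    assert (Hx1 : x <= m / 2) by apply Rmin_l.
    assert (Hx2 : x <= Cmod d / (2 * (Rabs K + Cmod e + 1))) by apply Rmin_r.
    apply Rmult_le_compat_r with (r := 2 * (Rabs K + Cmod e + 1)) in Hx2; [|lra].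
    unfold Rdiv in Hx2; rewrite Rmult_assoc, Rinv_l in Hx2 by lra.
    specialize (HK x ltac:(lra)).
    pose proof (Cmod_triangle (d + x * e) (- (x * e))) as T.
    rewrite Cmod_opp, Cmod_mult, Cmod_R, Rabs_pos_eq in T by lra.
    replace (d + x * e + - (x * e))%C with d in T by ring.
    nra. }
  assert (H0 : (a - a' = 0)%C).
  { apply (Z _ ((b - b') + RtoC (0) * (c - c'))%C (Rabs (M + N) + Cmod (c - c')) (Rmin 1 (Rmin r s))).
    - apply Rmin_glb_lt; lra.
    - intros x [Hx0 Hx].
      pose proof (Rmin_l 1 (Rmin r s)); pose proof (Rmin_r 1 (Rmin r s)).
      specialize (Hd x ltac:(lra)).
      replace (a - a' + x * (b - b' + RtoC 0 * (c - c')))%C with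
        ((a - a' + x * (b - b' + x * (c - c'))) + - (x * x * (c - c')))%C by ring.
      eapply Rle_trans; [apply Cmod_triangle|].
      rewrite Cmod_opp, !Cmod_mult, !Cmod_R, Rabs_pos_eq by lra.
      pose proof (Cmod_ge_0 (c - c')).
      pose proof (Rle_abs (M + N)); pose proof (Rabs_pos (M + N)).
      assert (x ^ 3 <= x) by nra. assert (0 < x ^ 3) by (apply pow_lt; lra).
      assert ((M + N) * x ^ 3 <= Rabs (M + N) * x) by nra.
      assert (x * x * Cmod (c - c') <= Cmod (c - c') * x).
      { rewrite (Rmult_comm (Cmod _)); apply Rmult_le_compat_r; nra. }
      lra. }
  assert (H1 : (b - b' = 0)%C).
  { apply (Z _ (c - c')%C (Rabs (M + N)) (Rmin 1 (Rmin r s))).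
    - apply Rmin_glb_lt; lra.
    - intros x [Hx0 Hx].
      pose proof (Rmin_l 1 (Rmin r s)); pose proof (Rmin_r 1 (Rmin r s)).
      specialize (Hd x ltac:(lra)).
      rewrite H0, Cplus_0_l, Cmod_mult, Cmod_R, Rabs_pos_eq in Hd by lra.
      pose proof (Rle_abs (M + N)); pose proof (Rabs_pos (M + N)).
      apply Rmult_le_reg_l with x; [lra|].
      assert (x ^ 3 <= x * x) by nra. assert (0 < x ^ 3) by (apply pow_lt; lra).
      nra. }
  assert (H2 : (c - c' = 0)%C).
  { apply (Z _ (RtoC 0) (Rabs (M + N)) (Rmin 1 (Rmin r s))).
    - apply Rmin_glb_lt; lra.
    - intros x [Hx0 Hx].
      pose proof (Rmin_l 1 (Rmin r s)); pose proof (Rmin_r 1 (Rmin r s)).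
      specialize (Hd x ltac:(lra)).
      rewrite H0, H1, !Cplus_0_l, !Cmod_mult, Cmod_R, Rabs_pos_eq in Hd by lra.
      replace (c - c' + x * RtoC 0)%C with (c - c')%C by ring.
      pose proof (Rle_abs (M + N)).
      apply Rmult_le_reg_l with (x * x); [nra|].
      assert (0 < x ^ 3) by (apply pow_lt; lra).
      nra. }
  assert (S : forall u v : C, (u - v = 0)%C -> u = v).
  { intros u v Huv; replace u with (u - v + v)%C by ring; rewrite Huv; ring. }
  auto.
Qed.

Lemma jet_unique (f : C -> C) (a b c a' b' c' : C) :
  jet f a b c -> jet f a' b' c' -> a = a' /\ b = b' /\ c = c'.
Proof.
  intros H [q [[M HM] E]].
  destruct (near0_and _ _ HM E) as [r [Hr H']].
  apply (jet_unique_real f a b c a' b' c' r M H Hr).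
  intros x Hx; destruct (H' (RtoC x)) as [Hq Ex].
  - intros Hc; apply RtoC_inj in Hc; lra.
  - rewrite Cmod_R, Rabs_pos_eq; lra.
  - rewrite Ex.
    replace (a' + b' * x + c' * (x * x) + x * x * x * q x
              - (a' + b' * x + c' * (x * x)))%C with (x * x * x * q x)%C by ring.
    rewrite !Cmod_mult, Cmod_R, Rabs_pos_eq by lra.
    assert (0 < x * x * x) by (repeat apply Rmult_lt_0_compat; lra).
    nra.
Qed.

(** * Complex power series *)

Definition Cseries (u : nat -> C) (l : C) : Prop :=
  @is_series C_AbsRing C_NormedModule u l.

Lemma Cseries_le (u : nat -> C) (b : nat -> R) (l : C) (B : R) :
  Cseries u l -> is_series b B -> (forall n, Cmod (u n) <= b n) -> Cmod l <= B.
Proof.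
  intros Hu Hb Hle.
  apply (filterlim_le (F := eventually)
    (fun n => Cmod (@sum_n C_NormedModule u n))
    (fun n => sum_n b n) (Cmod l) B).
  - exists 0%nat; intros n _.
    eapply Rle_trans; [apply (norm_sum_n_m (V := C_NormedModule))|].
    apply sum_n_m_le, Hle.
  - eapply filterlim_comp; [exact Hu|apply (filterlim_norm (V := C_NormedModule))].
  - exact Hb.
Qed.

Lemma Cseries_unique (u : nat -> C) (l l' : C) :
  Cseries u l -> Cseries u l' -> l = l'.
Proof. intros H H'; exact (filterlim_locally_unique (V := C_NormedModule) _ _ _ H H'). Qed.

Lemma Cseries_term_bounded (u : nat -> C) (l : C) :
  Cseries u l -> exists M : R, forall n, Cmod (u n) <= M.
Proof.
  intros H.
  destruct (filterlim_bounded (V := C_NormedModule) (sum_n u) (ex_intro _ l H)) as [M HM].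
  exists (M + M); intros [|n].
  - specialize (HM 0%nat); rewrite sum_O in HM.
    change (Cmod (u 0%nat) <= M) in HM.
    pose proof (Cmod_ge_0 (u 0%nat)); lra.
  - pose proof (HM n) as H1; pose proof (HM (S n)) as H2.
    rewrite sum_Sn in H2; revert H1 H2.
    generalize (@sum_n C_AbelianMonoid u n); intros s H1 H2.
    change (Cmod s <= M) in H1; change (Cmod (s + u (S n))%C <= M) in H2.
    replace (u (S n)) with ((s + u (S n)) + - s)%C by ring.
    eapply Rle_trans; [apply Cmod_triangle|].
    rewrite Cmod_opp; apply Rplus_le_compat; assumption.
Qed.

Lemma pow_n_Cpow (z : C) (n : nat) : @pow_n C_Ring z n = (z ^ n)%C.
Proof.
  induction n as [|n IH]; [reflexivity|].
  rewrite Cpow_S, <- IH; reflexivity.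
Qed.

Definition Cpseries (a : nat -> C) (z l : C) : Prop :=
  @is_pseries C_AbsRing C_NormedModule a z l.

Lemma Cpseries_series (a : nat -> C) (z l : C) :
  Cpseries a z l <-> Cseries (fun n => z ^ n * a n)%C l.
Proof.
  split; apply is_series_ext; intros n; rewrite <- pow_n_Cpow; reflexivity.
Qed.

(** Convergence at one point [r / 2] bounds the terms there, hence dominates the
    series on the disk of half that radius by a geometric one. *)
Lemma Cpseries_bounded0 (f : C -> C) (a : nat -> C) :
  near0 (fun z => Cpseries a z (f z)) -> bounded0 f.
Proof.
  intros [r [Hr H]].
  assert (H0 : Cpseries a (RtoC (r / 2)) (f (RtoC (r / 2)))).
  { apply H.
    - intros Hc; apply RtoC_inj in Hc; lra.
    - rewrite Cmod_R, Rabs_pos_eq; lra. }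
  apply Cpseries_series, Cseries_term_bounded in H0; destruct H0 as [M HM].
  exists (/ (1 - / 2) * M), (r / 4); split; [lra|].
  intros z Hz Hlt; assert (Hzr : Cmod z < r) by lra.
  specialize (H z Hz Hzr); apply Cpseries_series in H.
  refine (Cseries_le _ (fun n => (/ 2) ^ n * M) _ _ H _ _).
  - apply is_series_scal_r, is_series_geom; rewrite Rabs_pos_eq; lra.
  - intros n; specialize (HM n).
    rewrite Cmod_mult, Cmod_pow, Cmod_R, Rabs_pos_eq in HM by lra.
    rewrite Cmod_mult, Cmod_pow.
    eapply Rle_trans; [|apply Rmult_le_compat_l; [|exact HM]].
    + rewrite <- Rmult_assoc; apply Rmult_le_compat_r; [apply Cmod_ge_0|].
      rewrite <- Rpow_mult_distr; apply pow_incr.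
      pose proof (Cmod_ge_0 z); lra.
    + apply pow_le; lra.
Qed.

Lemma Cpseries_shift (f : C -> C) (a : nat -> C) :
  near0 (fun z => Cpseries a z (f z)) ->
  near0 (fun z => Cpseries (fun n => a (S n)) z ((f z - a 0%nat) / z)%C).
Proof.
  apply near0_imp; intros z Hz H.
  replace ((f z - a 0%nat) / z)%C with (/ z * (f z + - a 0%nat))%C
    by (field; assumption).
  apply (is_pseries_decr_1 a z (/ z)%C (f z)); [|exact H].
  change ((/ z * z)%C = RtoC 1); field; assumption.
Qed.

(** Three shifts [f |-> (f - f(0)) / z] leave a convergent power series, which is
    bounded: this is the remainder. *)
Lemma Cpseries_jet (f : C -> C) (a : nat -> C) :
  near0 (fun z => Cpseries a z (f z)) -> jet f (a 0%nat) (a 1%nat) (a 2%nat).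
Proof.
  intros H.
  generalize (Cpseries_bounded0 _ _ (Cpseries_shift _ _
               (Cpseries_shift _ _ (Cpseries_shift _ _ H)))).
  intros Hb; eexists; split; [exact Hb|].
  exists 1; split; [lra|]; intros z Hz _; cbv beta; field; assumption.
Qed.

Lemma Cpseries_jet_shift (f : C -> C) (a : nat -> C) :
  a 0%nat = RtoC 0 -> near0 (fun z => Cpseries a z (f z)) ->
  jet (fun z => f z / z)%C (a 1%nat) (a 2%nat) (a 3%nat).
Proof.
  intros H0 H; generalize (Cpseries_jet _ _ (Cpseries_shift _ _ H)).
  apply jet_ext; exists 1; split; [lra|]; intros z Hz _.
  rewrite H0; field; assumption.
Qed.

Lemma Cpseries_at_0 (a : nat -> C) (l : C) : Cpseries a (RtoC 0) l -> l = a 0%nat.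
Proof.
  intros H; apply Cpseries_series in H.
  refine (Cseries_unique _ _ _ H _).
  apply (filterlim_ext (fun _ => a 0%nat)); [|apply filterlim_const].
  intros n; induction n as [|n IH].
  - rewrite sum_O; change (a 0%nat = RtoC 1 * a 0%nat)%C; ring.
  - rewrite sum_Sn, <- IH; rewrite Cpow_S.
    change (a 0%nat = (a 0%nat + RtoC 0 * RtoC 0 ^ n * a (S n))%C); ring.
Qed.

(** [C_lim] is the limit of each coordinate along the horizontal line through
    [z], which the estimate controls. *)
Lemma C_lim_of_bound (f : C -> C) (z l : C) (d K : R) :
  0 < d ->
  (forall y, y <> z -> Cmod (y - z)%C < d -> Cmod (f y - l)%C <= K * Cmod (y - z)%C) ->
  C_lim f z = l.
Proof.
  intros Hd H.
  assert (HL : forall p : C -> R, (forall u v, Rabs (p u - p v) <= Cmod (u - v)%C) ->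
      Lim (fun x : R => p (f (x, snd z))) (fst z) = p l).
  { intros p Hp; apply is_lim_unique, is_lim_spec; intros e.
    pose proof (cond_pos e); pose proof (Rabs_pos K); pose proof (Rle_abs K).
    assert (Hm : 0 < Rmin d (e / (Rabs K + 1))).
    { apply Rmin_glb_lt; [assumption|apply Rdiv_lt_0_compat; lra]. }
    exists (mkposreal _ Hm); intros x Hx Hne; simpl in Hx.
    change (Rabs (x - fst z) < Rmin d (e / (Rabs K + 1))) in Hx.
    pose proof (Rmin_l d (e / (Rabs K + 1))).
    pose proof (Rmin_r d (e / (Rabs K + 1))).
    assert (E : ((x, snd z) - z)%C = RtoC (x - fst z)).
    { destruct z as [z1 z2]; unfold Cminus, Cplus, Copp, RtoC; simpl.
      f_equal; ring. }
    eapply Rle_lt_trans; [apply Hp|].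
    eapply Rle_lt_trans; [apply H|].
    - intros Hc; apply Hne; rewrite <- Hc; reflexivity.
    - change (Cmod ((x, snd z) - z)%C < d); rewrite E, Cmod_R; lra.
    - change (K * Cmod ((x, snd z) - z)%C < e); rewrite E, Cmod_R.
      assert (Hlt : Rabs (x - fst z) < e / (Rabs K + 1)) by lra.
      apply Rmult_lt_compat_r with (r := Rabs K + 1) in Hlt; [|lra].
      unfold Rdiv in Hlt; rewrite Rmult_assoc, Rinv_l in Hlt by lra.
      pose proof (Rabs_pos (x - fst z)); nra. }
  assert (HM : forall u v : C, Rabs (fst u - fst v) <= Cmod (u - v)%C /\
                               Rabs (snd u - snd v) <= Cmod (u - v)%C).
  { intros u v; pose proof (Rmax_Cmod (u - v)%C) as HR; simpl in HR.
    pose proof (Rmax_l (Rabs (fst u + - fst v)) (Rabs (snd u + - snd v))).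
    pose proof (Rmax_r (Rabs (fst u + - fst v)) (Rabs (snd u + - snd v))).
    unfold Rminus; split; lra. }
  unfold C_lim; rewrite (HL fst), (HL snd).
  - destruct l; reflexivity.
  - intros; apply HM.
  - intros; apply HM.
Qed.

(** The remainder [D n] of the first-order expansion of [z^n] obeys
    [D (n + 1) = (z + h) D n + n h^2 z^(n-1)], a recursion with nonnegative
    coefficients.  Its modulus is therefore dominated by the real remainder with
    increment [d], in which every term carries a factor [d^2]. *)
Lemma Cpow_increment_bound (z h : C) (d : R) (n : nat) :
  0 < d -> Cmod h <= d ->
  Cmod ((z + h) ^ S n - z ^ S n - INR (S n) * h * z ^ n)%C
   <= (Cmod h / d) ^ 2 *
      ((Cmod z + d) ^ S n - Cmod z ^ S n - INR (S n) * d * Cmod z ^ n).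
Proof.
  intros Hd Hh.
  pose proof (Cmod_ge_0 z); pose proof (Cmod_ge_0 h).
  induction n as [|n IH].
  - replace ((z + h) ^ 1 - z ^ 1 - INR 1 * h * z ^ 0)%C with (RtoC 0)
      by (simpl; ring).
    rewrite Cmod_0; apply Req_le; simpl; ring.
  - replace ((z + h) ^ S (S n) - z ^ S (S n) - INR (S (S n)) * h * z ^ S n)%C
      with ((z + h) * ((z + h) ^ S n - z ^ S n - INR (S n) * h * z ^ n)
            + INR (S n) * (h * h) * z ^ n)%C
      by (rewrite (S_INR (S n)), RtoC_plus, !Cpow_S; ring).
    eapply Rle_trans; [apply Cmod_triangle|].
    rewrite !Cmod_mult, Cmod_R, Cmod_pow, (Rabs_pos_eq _ (pos_INR _)).
    set (D := Cmod (_ - _ - _)%C) in *.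
    set (Er := (Cmod z + d) ^ S n - Cmod z ^ S n - INR (S n) * d * Cmod z ^ n) in *.
    replace ((Cmod z + d) ^ S (S n) - Cmod z ^ S (S n)
             - INR (S (S n)) * d * Cmod z ^ S n)
      with ((Cmod z + d) * Er + INR (S n) * (d * d) * Cmod z ^ n)
      by (unfold Er; rewrite (S_INR (S n)); simpl; ring).
    replace ((Cmod h / d) ^ 2 * ((Cmod z + d) * Er + INR (S n) * (d * d) * Cmod z ^ n))
      with ((Cmod z + d) * ((Cmod h / d) ^ 2 * Er)
            + INR (S n) * (Cmod h * Cmod h) * Cmod z ^ n) by (field; lra).
    apply Rplus_le_compat_r.
    apply Rmult_le_compat; [apply Cmod_ge_0|apply Cmod_ge_0| |exact IH].
    eapply Rle_trans; [apply Cmod_triangle|lra].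
Qed.

Lemma pow_increment_linear (x d : R) (n : nat) :
  0 <= x -> 0 < d -> INR (S n) * d * x ^ n <= (x + d) ^ S n - x ^ S n.
Proof.
  intros Hx Hd; induction n as [|n IH].
  - simpl; lra.
  - pose proof (pow_le x n Hx); pose proof (pos_INR n).
    rewrite S_INR in IH.
    rewrite (S_INR (S n)), S_INR; simpl in *.
    apply Rmult_le_compat_l with (r := x + d) in IH; [|lra].
    assert (0 <= (INR n + 1) * (d * d) * x ^ n)
      by (repeat apply Rmult_le_pos; lra).
    nra.
Qed.

Definition derived_seq (a : nat -> C) : nat -> C :=
  fun n => (INR (S n) * a (S n))%C.

Lemma Cpseries_abs_convergent (f : C -> C) (a : nat -> C) (x : R) :
  has_expansion f a -> 0 <= x < 1 -> ex_series (fun n => x ^ n * Cmod (a n)).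
Proof.
  intros Hf Hx.
  set (y := (x + 1) / 2).
  assert (Hy : x < y < 1) by (unfold y; lra).
  assert (Hd : in_disk (RtoC y)).
  { unfold in_disk; rewrite Cmod_R, Rabs_pos_eq; lra. }
  generalize (Hf _ Hd); intros H.
  apply Cpseries_series, Cseries_term_bounded in H; destruct H as [M HM].
  apply (ex_series_le (K := R_AbsRing) (V := R_CompleteNormedModule)
           _ (fun n => (x / y) ^ n * M)).
  - intros n; change (Rabs (x ^ n * Cmod (a n)) <= (x / y) ^ n * M).
    specialize (HM n).
    rewrite Cmod_mult, Cmod_pow, Cmod_R, (Rabs_pos_eq y) in HM by lra.
    assert (Hq : 0 <= x / y) by (apply Rdiv_le_0_compat; lra).
    rewrite Rabs_pos_eq.
    + replace (x ^ n) with ((x / y) ^ n * y ^ n).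
      * rewrite Rmult_assoc; apply Rmult_le_compat_l; [apply pow_le|]; assumption.
      * rewrite <- Rpow_mult_distr; f_equal; field; lra.
    + apply Rmult_le_pos; [apply pow_le; lra|apply Cmod_ge_0].
  - exists (/ (1 - x / y) * M); apply is_series_scal_r, is_series_geom.
    rewrite Rabs_pos_eq by (apply Rdiv_le_0_compat; lra).
    apply Rmult_lt_reg_r with y; [lra|].
    unfold Rdiv; rewrite Rmult_assoc, Rinv_l; lra.
Qed.

(** With [d] such that [|z| + d < 1], the quantity
    [f (z + h) - f z - h l] is a series whose terms are at most
    [(|h| / d)^2 (|z| + d)^n |a n|], so it is [O(h^2)]. *)
Lemma has_expansion_C_derive (f : C -> C) (a : nat -> C) :
  has_expansion f a -> has_expansion (C_derive f) (derived_seq a).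
Proof.
  intros Hf z Hz; unfold in_disk in Hz.
  pose proof (Cmod_ge_0 z) as Hz0.
  set (d := (1 - Cmod z) / 2).
  assert (Hd : 0 < d) by (unfold d; lra).
  assert (Hzd : 0 <= Cmod z + d < 1) by (unfold d; lra).
  assert (HBe : exists B : R,
            is_series (fun n => (Cmod z + d) ^ n * Cmod (a n)) B)
    by exact (Cpseries_abs_convergent _ _ _ Hf Hzd).
  destruct HBe as [B HB].
  assert (HB1 := is_series_incr_1 (fun n => (Cmod z + d) ^ n * Cmod (a n))
                   (B - (Cmod z + d) ^ 0 * Cmod (a 0%nat))).
  set (B1 := B - (Cmod z + d) ^ 0 * Cmod (a 0%nat)) in *.
  assert (HS : is_series (fun n => (Cmod z + d) ^ S n * Cmod (a (S n))) B1).
  { apply HB1; replace (plus B1 _) with B; [exact HB|].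
    change (@eq R B (B1 + (Cmod z + d) ^ 0 * Cmod (a 0%nat))); unfold B1; ring. }
  clearbody B1; clear HB HB1 B.
  assert (Hex : exists l : C, Cseries (fun n => z ^ n * derived_seq a n)%C l).
  { apply (ex_series_le (K := C_AbsRing) (V := C_CompleteNormedModule)
        _ (fun n => / d * ((Cmod z + d) ^ S n * Cmod (a (S n))))).
    - intros n; change (Cmod (z ^ n * derived_seq a n)%C
                         <= / d * ((Cmod z + d) ^ S n * Cmod (a (S n)))).
      unfold derived_seq.
      rewrite !Cmod_mult, Cmod_R, Cmod_pow, (Rabs_pos_eq _ (pos_INR _)).
      rewrite <- !Rmult_assoc; apply Rmult_le_compat_r; [apply Cmod_ge_0|].
      apply Rmult_le_reg_l with d; [assumption|].
      replace (d * (/ d * (Cmod z + d) ^ S n)) with ((Cmod z + d) ^ S n)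
        by (field; lra).
      pose proof (pow_increment_linear (Cmod z) d n Hz0 Hd).
      pose proof (pow_le (Cmod z) (S n) Hz0); lra.
    - exists (/ d * B1); apply (is_series_scal_l (/ d) _ B1 HS). }
  destruct Hex as [l Hl].
  apply Cpseries_series.
  replace (C_derive f z) with l; [exact Hl|].
  symmetry; apply (C_lim_of_bound _ _ _ d (/ d ^ 2 * B1)); [assumption|].
  intros y Hy Hyd.
  set (h := (y - z)%C) in *.
  assert (Ey : y = (z + h)%C) by (unfold h; ring).
  assert (Hh : h <> RtoC 0).
  { intros Hc; apply Hy; rewrite Ey, Hc; ring. }
  assert (Hyin : in_disk y).
  { unfold in_disk; rewrite Ey.
    eapply Rle_lt_trans; [apply Cmod_triangle|lra]. }
  assert (Hsy := proj1 (Cpseries_series _ _ _) (Hf y Hyin)).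
  assert (Hsz := proj1 (Cpseries_series _ _ _) (Hf z Hz)).
  assert (Hdiff : Cseries (fun n => (y ^ S n - z ^ S n - INR (S n) * h * z ^ n)
                                     * a (S n))%C (f y - f z - h * l)%C).
  { assert (H1 : Cseries (fun n => y ^ S n * a (S n) + - (z ^ S n * a (S n)))%C
                   (f y - f z)%C).
    { apply (is_series_incr_1 (fun n => y ^ n * a n + - (z ^ n * a n))%C).
      match goal with |- is_series _ ?L => replace L with (f y + - f z)%C end.
      - exact (is_series_minus _ _ _ _ Hsy Hsz).
      - change (@eq C (f y + - f z)%C ((f y - f z)
                  + (RtoC 1 * a 0%nat + - (RtoC 1 * a 0%nat)))%C); ring. }
    generalize (is_series_minus _ _ _ _ H1 (is_series_scal_l h _ _ Hl)).
    apply is_series_ext; intros n.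
    change (@eq C ((y ^ S n * a (S n) + - (z ^ S n * a (S n)))
             + - (h * (z ^ n * derived_seq a n)))%C
            ((y ^ S n - z ^ S n - INR (S n) * h * z ^ n) * a (S n))%C).
    unfold derived_seq; ring. }
  replace ((f y - f z) / h - l)%C with ((f y - f z - h * l) / h)%C
    by (field; assumption).
  apply Cmod_gt_0 in Hh.
  rewrite Cmod_div by (apply Cmod_gt_0; assumption).
  apply Rmult_le_reg_r with (Cmod h); [assumption|].
  unfold Rdiv; rewrite Rmult_assoc, Rinv_l, Rmult_1_r by lra.
  replace (/ d ^ 2 * B1 * Cmod h * Cmod h) with ((Cmod h / d) ^ 2 * B1)
    by (field; lra).
  refine (Cseries_le _ (fun n => (Cmod h / d) ^ 2 *
            ((Cmod z + d) ^ S n * Cmod (a (S n)))) _ _ Hdiff _ _).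
  - apply (is_series_scal_l ((Cmod h / d) ^ 2) _ B1 HS).
  - intros n; rewrite Cmod_mult, Ey, <- Rmult_assoc.
    apply Rmult_le_compat_r; [apply Cmod_ge_0|].
    eapply Rle_trans; [apply (Cpow_increment_bound z h d n Hd); lra|].
    apply Rmult_le_compat_l; [apply pow2_ge_0|].
    pose proof (pow_le (Cmod z) (S n) Hz0); pose proof (pow_le (Cmod z) n Hz0).
    pose proof (pos_INR (S n)).
    assert (0 <= INR (S n) * d * Cmod z ^ n)
      by (apply Rmult_le_pos; [apply Rmult_le_pos|]; lra).
    lra.
Qed.

(** * The maximum principle *)

Definition in_closed_disk (r : R) (z : C) : Prop := Cmod z <= r.

(** Compactness of the closed disk: the gauge at each point is chosen below the
    inverse of a local bound of [u], so that a uniform lower bound of the gauge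
    is a global bound of [u]. *)
Lemma locally_bounded_bounded (r : R) (u : C -> R) :
  (forall z, in_closed_disk r z -> exists e M, 0 < e /\
     forall y, in_closed_disk r y -> Cmod (y - z)%C < e -> u y <= M) ->
  exists B, forall z, in_closed_disk r z -> u z <= B.
Proof.
  intros H.
  assert (HD : forall z : C, exists e : posreal,
     forall y, in_closed_disk r y -> Cmod (y - z)%C < 2 * e -> u y <= / e).
  { intros z; destruct (Rle_or_lt (Cmod z) r) as [Hz|Hz].
    - destruct (H z Hz) as [e [M [He HM]]].
      pose proof (Rabs_pos M); pose proof (Rle_abs M).
      assert (Hp : 0 < Rmin (e / 2) (/ (Rabs M + 1))).
      { apply Rmin_glb_lt; [lra|apply Rinv_0_lt_compat; lra]. }
      exists (mkposreal _ Hp); simpl; intros y Hy Hyz.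
      pose proof (Rmin_l (e / 2) (/ (Rabs M + 1))) as L1.
      pose proof (Rmin_r (e / 2) (/ (Rabs M + 1))) as L2.
      apply Rle_trans with M; [apply HM; [assumption|lra]|].
      apply Rle_trans with (/ / (Rabs M + 1)); [rewrite Rinv_inv; lra|].
      apply Rinv_le_contravar; assumption.
    - assert (Hp : 0 < (Cmod z - r) / 2) by lra.
      exists (mkposreal _ Hp); simpl; intros y Hy Hyz; exfalso.
      pose proof (Cmod_triangle y (- (y - z))) as T.
      rewrite Cmod_opp in T.
      replace (y + - (y - z))%C with z in T by ring.
      unfold in_closed_disk in Hy; lra. }
  (* the gauge measures squares, whose points are at distance at most
     [sqrt 2 * e < 2 * e] from the centre *)
  set (delta := fun x y => proj1_sig (constructive_indefinite_description _ (HD (x, y)))).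
  destruct (compactness_value_2d (- r) r (- r) r delta) as [d Hd].
  exists (/ d); intros [x y] Hz.
  pose proof (Rmax_Cmod (x, y)) as HR; simpl in HR; unfold in_closed_disk in Hz.
  pose proof (Rmax_l (Rabs x) (Rabs y)); pose proof (Rmax_r (Rabs x) (Rabs y)).
  assert (Hx : - r <= x <= r) by (apply Rabs_le_between; lra).
  assert (Hy : - r <= y <= r) by (apply Rabs_le_between; lra).
  destruct (NNPP _ (Hd x y Hx Hy)) as (a & b & _ & _ & Ha & Hb & Hdl).
  unfold delta in Ha, Hb, Hdl; revert Ha Hb Hdl.
  destruct (constructive_indefinite_description _ (HD (a, b))) as [e He]; simpl.
  intros Ha Hb Hdl.
  apply Rle_trans with (/ e).
  - apply He; [exact Hz|].
    eapply Rle_lt_trans; [apply Cmod_2Rmax|].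
    change (sqrt 2 * Rmax (Rabs (x - a)) (Rabs (y - b)) < 2 * e).
    assert (Hs : sqrt 2 <= 2).
    { rewrite <- (sqrt_square 2) at 2 by lra; apply sqrt_le_1_alt; lra. }
    pose proof (Rmax_lub_lt _ _ _ Ha Hb).
    pose proof (Rle_trans _ _ _ (Rabs_pos _) (Rmax_l (Rabs (x - a)) (Rabs (y - b)))).
    nra.
  - apply Rinv_le_contravar; [apply cond_pos|assumption].
Qed.

Lemma usc_attains_max (r : R) (u : C -> R) :
  0 <= r ->
  (forall z, in_closed_disk r z -> forall eta, 0 < eta -> exists e, 0 < e /\
     forall y, in_closed_disk r y -> Cmod (y - z)%C < e -> u y < u z + eta) ->
  exists z, in_closed_disk r z /\ forall y, in_closed_disk r y -> u y <= u z.
Proof.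
  intros Hr Hu.
  destruct (locally_bounded_bounded r u) as [B HB].
  { intros z Hz; destruct (Hu z Hz 1 ltac:(lra)) as [e [He H]].
    exists e, (u z + 1); split; [assumption|].
    intros y Hy Hyz; left; auto. }
  destruct (completeness (fun v => exists z, in_closed_disk r z /\ v = u z)) as [M [HM1 HM2]].
  - exists B; intros v [z [Hz ->]]; auto.
  - exists (u (RtoC 0)), (RtoC 0); split; [|reflexivity].
    unfold in_closed_disk; rewrite Cmod_0; assumption.
  - apply NNPP; intros HN.
    assert (Hlt : forall z, in_closed_disk r z -> u z < M).
    { intros z Hz.
      assert (u z <= M) by (apply HM1; exists z; auto).
      destruct (Rle_lt_or_eq_dec (u z) M) as [|E]; [assumption|assumption|].
      exfalso; apply HN; exists z; split; [assumption|].
      intros y Hy; rewrite E; apply HM1; exists y; auto. }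
    (* 1 / (M - u) is again locally bounded, hence bounded, so that M is not
       the least upper bound *)
    destruct (locally_bounded_bounded r (fun z => / (M - u z))) as [B' HB'].
    { intros z Hz; specialize (Hlt z Hz).
      destruct (Hu z Hz ((M - u z) / 2) ltac:(lra)) as [e [He H]].
      exists e, (/ ((M - u z) / 2)); split; [assumption|].
      intros y Hy Hyz; specialize (H y Hy Hyz).
      apply Rinv_le_contravar; lra. }
    pose proof (Rabs_pos B'); pose proof (Rle_abs B').
    assert (Hp : 0 < / (Rabs B' + 1)) by (apply Rinv_0_lt_compat; lra).
    assert (M <= M - / (Rabs B' + 1)); [|lra].
    apply HM2; intros v [z [Hz ->]].
    specialize (Hlt z Hz); specialize (HB' z Hz).
    assert (/ (Rabs B' + 1) <= M - u z); [|lra].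
    rewrite <- (Rinv_inv (M - u z)); apply Rinv_le_contravar; [|lra].
    apply Rinv_0_lt_compat; lra.
Qed.

Lemma Cmod_pow2_plus_ge (p q : C) (L N : R) :
  Cmod p <= L -> Cmod q <= N -> Cmod p ^ 2 - 2 * L * N <= Cmod (p + q)%C ^ 2.
Proof.
  intros Hp Hq.
  pose proof (Cmod_triangle (p + q) (- q)) as T; rewrite Cmod_opp in T.
  replace (p + q + - q)%C with p in T by ring.
  pose proof (Cmod_ge_0 p); pose proof (Cmod_ge_0 q); pose proof (Cmod_ge_0 (p + q)).
  assert (Cmod p * Cmod q <= L * N) by (apply Rmult_le_compat; assumption).
  destruct (Rle_or_lt (Cmod p) (Cmod q)); nra.
Qed.

(** Parseval's identity on the fourth roots of unity, exact because the degree is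
    less than four. *)
Lemma four_point_parseval (a b c : C) (x : R) :
  let P := fun u : C => (a + b * (x * u) + c * ((x * u) * (x * u)))%C in
  Cmod (P 1) ^ 2 + Cmod (P (- (1))%C) ^ 2 + Cmod (P Ci) ^ 2 + Cmod (P (- Ci)%C) ^ 2
   = 4 * (Cmod a ^ 2 + Cmod b ^ 2 * x ^ 2 + Cmod c ^ 2 * x ^ 4).
Proof.
  destruct a as [a1 a2], b as [b1 b2], c as [c1 c2].
  cbv beta zeta; rewrite !Cmod2_alt.
  unfold Re, Im, Ci, RtoC, Cmult, Cplus, Copp; simpl; ring.
Qed.

Lemma Cmod_fourth_root_of_unity (u : C) :
  u = RtoC 1 \/ u = (- (1))%C \/ u = Ci \/ u = (- Ci)%C -> Cmod u = 1.
Proof.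
  intros [->|[->|[->| ->]]]; rewrite ?Cmod_opp, ?Cmod_1, ?Cmod_Ci; reflexivity.
Qed.

(** If no such [v] existed, summing over [v = x u], [u] a fourth root of unity,
    would give [eps x^2 = O(x^3)]: the sum of the squared moduli of the
    quadratic part of [h] is at least four times the central one by Parseval,
    and the sum of the [|z + v|^2] exceeds four times [|z|^2] by [4 x^2]. *)
Lemma jet_strict_submean (h : C -> C) (z b c : C) (eps r : R) :
  0 < eps -> 0 < r -> jet (fun v => h (z + v)%C) (h z) b c ->
  exists v, Cmod v < r /\
    Cmod (h z) ^ 2 + eps * Cmod z ^ 2 < Cmod (h (z + v)%C) ^ 2 + eps * Cmod (z + v)%C ^ 2.
Proof.
  intros He Hr [q [[M HM] E]].
  destruct (near0_and _ _ HM E) as [s [Hs H]]; clear HM E.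
  set (a := h z) in *.
  pose proof (Cmod_ge_0 a); pose proof (Cmod_ge_0 b); pose proof (Cmod_ge_0 c).
  set (L := Cmod a + Cmod b + Cmod c).
  assert (HL : 0 <= L) by (unfold L; lra).
  pose proof (Rabs_pos M); pose proof (Rle_abs M).
  assert (HLM : 0 <= L * Rabs M) by (apply Rmult_le_pos; assumption).
  set (m := Rmin (Rmin s r) (Rmin 1 (eps / (2 * (L * Rabs M) + 1)))).
  assert (Hm : 0 < m).
  { repeat apply Rmin_glb_lt; try lra; apply Rdiv_lt_0_compat; lra. }
  set (x := m / 2).
  assert (Hx : 0 < x /\ x < s /\ x < r /\ x < 1 /\
               x * (2 * (L * Rabs M) + 1) < eps).
  { assert (m <= Rmin s r) by apply Rmin_l.
    assert (m <= Rmin 1 (eps / (2 * (L * Rabs M) + 1))) by apply Rmin_r.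
    pose proof (Rmin_l s r); pose proof (Rmin_r s r).
    pose proof (Rmin_l 1 (eps / (2 * (L * Rabs M) + 1))).
    pose proof (Rmin_r 1 (eps / (2 * (L * Rabs M) + 1))).
    assert (Hlt : x < eps / (2 * (L * Rabs M) + 1)) by (unfold x; lra).
    apply Rmult_lt_compat_r with (r := 2 * (L * Rabs M) + 1) in Hlt; [|lra].
    unfold Rdiv in Hlt; rewrite Rmult_assoc, Rinv_l in Hlt by lra.
    repeat split; try (unfold x; lra); lra. }
  destruct Hx as (Hx0 & Hxs & Hxr & Hx1 & Hxe).
  apply NNPP; intros HN.
  set (P := fun u : C => (a + b * (x * u) + c * ((x * u) * (x * u)))%C).
  assert (HU : forall u, Cmod u = 1 ->
     Cmod (P u) ^ 2 - 2 * L * (x ^ 3 * Rabs M) + eps * Cmod (z + x * u)%C ^ 2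
      <= Cmod a ^ 2 + eps * Cmod z ^ 2).
  { intros u Hu.
    assert (Hxu : Cmod (x * u)%C = x)
      by (rewrite Cmod_mult, Cmod_R, Hu, Rabs_pos_eq; lra).
    destruct (H (x * u)%C) as [HM E].
    - apply Cmod_gt_0; lra.
    - lra.
    - apply Rnot_lt_le; intros Hlt; apply HN.
      exists (x * u)%C; split; [lra|].
      eapply Rlt_le_trans; [exact Hlt|].
      apply Rplus_le_compat_r; rewrite E.
      change (a + b * (x * u) + c * ((x * u) * (x * u)))%C with (P u).
      apply Cmod_pow2_plus_ge.
      + unfold P, L.
        eapply Rle_trans; [apply Cmod_triangle|].
        eapply Rle_trans; [apply Rplus_le_compat_r, Cmod_triangle|].
        rewrite (Cmod_mult b), (Cmod_mult c), (Cmod_mult (x * u)), Hxu.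
        assert (Cmod b * x <= Cmod b) by nra.
        assert (x * x <= 1) by nra.
        assert (Cmod c * (x * x) <= Cmod c) by nra.
        lra.
      + rewrite !Cmod_mult, Cmod_R, Hu, Rabs_pos_eq by lra.
        assert (0 < x ^ 3) by (apply pow_lt; lra).
        assert (Cmod (q (x * u)%C) <= Rabs M) by lra.
        replace (x * 1 * (x * 1) * (x * 1)) with (x ^ 3) by ring.
        apply Rmult_le_compat_l; lra. }
  pose proof (HU 1%C ltac:(apply Cmod_fourth_root_of_unity; auto)) as U1.
  pose proof (HU (- (1))%C ltac:(apply Cmod_fourth_root_of_unity; auto)) as U2.
  pose proof (HU Ci ltac:(apply Cmod_fourth_root_of_unity; auto)) as U3.
  pose proof (HU (- Ci)%C ltac:(apply Cmod_fourth_root_of_unity; auto)) as U4.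
  pose proof (four_point_parseval a b c x) as FP; cbv zeta in FP.
  fold P in FP.
  assert (FZ : Cmod (z + x * 1)%C ^ 2 + Cmod (z + x * - (1))%C ^ 2
             + Cmod (z + x * Ci)%C ^ 2 + Cmod (z + x * - Ci)%C ^ 2
             = 4 * (Cmod z ^ 2 + x ^ 2)).
  { destruct z as [z1 z2]; rewrite !Cmod2_alt.
    unfold Re, Im, Ci, RtoC, Cmult, Cplus, Copp; simpl; ring. }
  assert (0 <= Cmod b ^ 2 * x ^ 2) by (apply Rmult_le_pos; apply pow2_ge_0).
  assert (0 <= Cmod c ^ 2 * x ^ 4)
    by (apply Rmult_le_pos; [apply pow2_ge_0|apply pow_le; lra]).
  assert (K : eps * x ^ 2 <= 2 * L * (x ^ 3 * Rabs M)).
  { nra. }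
  assert (0 < x ^ 2) by (apply pow_lt; lra).
  replace (2 * L * (x ^ 3 * Rabs M)) with (x * (2 * (L * Rabs M)) * x ^ 2) in K by ring.
  apply Rmult_le_reg_r in K; nra.
Qed.

(** If [|h 0| > B], then [|h|^2 + eps |z|^2] is larger at [0] than on the circle
    for small [eps], so its maximum over the closed disk is an interior one,
    against [jet_strict_submean]. *)
Lemma max_modulus (h : C -> C) (r B : R) :
  0 < r ->
  (forall z, in_closed_disk r z -> exists b c, jet (fun v => h (z + v)%C) (h z) b c) ->
  (forall z, Cmod z = r -> Cmod (h z) <= B) ->
  Cmod (h (RtoC 0)) <= B.
Proof.
  intros Hr Hj HB.
  apply Rnot_lt_le; intros Hlt.
  assert (HB0 : 0 <= B).
  { apply Rle_trans with (Cmod (h (RtoC r))); [apply Cmod_ge_0|].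
    apply HB; rewrite Cmod_R, Rabs_pos_eq; lra. }
  set (eps := (Cmod (h (RtoC 0)) ^ 2 - B ^ 2) / (2 * r ^ 2)).
  assert (Hr2 : 0 < r ^ 2) by (apply pow_lt; lra).
  assert (He : 0 < eps) by (apply Rdiv_lt_0_compat; nra).
  assert (Her : eps * r ^ 2 = (Cmod (h (RtoC 0)) ^ 2 - B ^ 2) / 2)
    by (unfold eps; field; lra).
  set (u := fun z => Cmod (h z) ^ 2 + eps * Cmod z ^ 2).
  destruct (usc_attains_max r u) as [z [Hz Hmax]]; [lra| |].
  - intros z Hz eta Heta.
    destruct (Hj z Hz) as (b & c & J).
    destruct (jet_tail _ _ _ _ J) as [k [Hk E]].
    pose proof (Cmod_ge_0 (h z)) as P1; pose proof (Cmod_ge_0 z) as P2.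
    set (W := 2 * Cmod (h z) + 1 + eps * (2 * Cmod z + 1)).
    assert (HW : 0 < W) by (unfold W; nra).
    set (t := Rmin 1 (eta / (2 * W))).
    assert (Ht : 0 < t) by (apply Rmin_glb_lt; [lra|apply Rdiv_lt_0_compat; lra]).
    assert (Ht1 : t <= 1) by apply Rmin_l.
    assert (Ht2 : t * W <= eta / 2).
    { assert (L : t <= eta / (2 * W)) by apply Rmin_r.
      apply Rmult_le_compat_r with (r := W) in L; [|lra].
      replace (eta / (2 * W) * W) with (eta / 2) in L by (field; lra); lra. }
    destruct (near0_and _ _ E (near0_mult_small _ _ Hk Ht)) as [d [Hd H]].
    exists (Rmin d t); split; [apply Rmin_glb_lt; assumption|].
    intros y Hy Hyz.
    pose proof (Rmin_l d t); pose proof (Rmin_r d t).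
    destruct (classic (y = z)) as [->|Hne]; [lra|].
    destruct (H (y - z)%C) as [E' L].
    + intros Hc; apply Hne; replace y with (y - z + z)%C by ring; rewrite Hc; ring.
    + lra.
    + replace (z + (y - z))%C with y in E' by ring.
      assert (L1 : Cmod (h y) <= Cmod (h z) + t).
      { rewrite E'; eapply Rle_trans; [apply Cmod_triangle|lra]. }
      assert (L2 : Cmod y <= Cmod z + t).
      { replace y with (z + (y - z))%C by ring.
        eapply Rle_trans; [apply Cmod_triangle|lra]. }
      assert (Q1 : Cmod (h y) ^ 2 <= Cmod (h z) ^ 2 + t * (2 * Cmod (h z) + 1)).
      { pose proof (Cmod_ge_0 (h y)).
        apply Rle_trans with ((Cmod (h z) + t) ^ 2); [apply pow_incr; lra|nra]. }
      assert (Q2 : Cmod y ^ 2 <= Cmod z ^ 2 + t * (2 * Cmod z + 1)).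
      { pose proof (Cmod_ge_0 y).
        apply Rle_trans with ((Cmod z + t) ^ 2); [apply pow_incr; lra|nra]. }
      apply Rmult_le_compat_l with (r := eps) in Q2; [|lra].
      unfold u, W in *; lra.
  - assert (H0 : u (RtoC 0) <= u z)
      by (apply Hmax; unfold in_closed_disk; rewrite Cmod_0; lra).
    unfold u in H0; rewrite Cmod_0 in H0.
    assert (Hin : Cmod z < r).
    { unfold in_closed_disk in Hz; destruct Hz as [Hz|Hz]; [assumption|exfalso].
      specialize (HB z Hz); rewrite Hz in H0.
      pose proof (Cmod_ge_0 (h z)); nra. }
    destruct (Hj z Hz) as (b & c & J).
    destruct (jet_strict_submean h z b c eps (r - Cmod z) He ltac:(lra) J)
      as [v [Hv Hgt]].
    assert (Hc : in_closed_disk r (z + v)%C).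
    { unfold in_closed_disk; eapply Rle_trans; [apply Cmod_triangle|lra]. }
    specialize (Hmax _ Hc); unfold u in Hmax; lra.
Qed.

Lemma analytic_at_pseries (f : C -> C) (z : C) :
  analytic_at f z ->
  exists a, a 0%nat = f z /\ near0 (fun v => Cpseries a v (f (z + v)%C)).
Proof.
  intros (r & a & Hr & H); exists a; split.
  - symmetry; apply Cpseries_at_0.
    specialize (H z); replace (z - z)%C with (RtoC 0) in H by ring.
    apply H; rewrite Cmod_0; assumption.
  - exists r; split; [assumption|]; intros v _ Hv.
    specialize (H (z + v)%C); replace (z + v - z)%C with v in H by ring.
    apply H; assumption.
Qed.

(** The constant term has to be the value [f z], about which [jet] says nothing. *)
Definition smooth_at (f : C -> C) (z : C) : Prop :=
  exists b c, jet (fun v => f (z + v)%C) (f z) b c.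

Lemma analytic_smooth_at (f : C -> C) (z : C) : analytic_at f z -> smooth_at f z.
Proof.
  intros H; destruct (analytic_at_pseries _ _ H) as (a & H0 & Ha).
  exists (a 1%nat), (a 2%nat); rewrite <- H0; apply Cpseries_jet; assumption.
Qed.

Lemma smooth_at_Cpow (k : nat) (z : C) : smooth_at (fun v => v ^ k)%C z.
Proof.
  induction k as [|k (b & c & IH)].
  - exists (RtoC 0), (RtoC 0); exact (jet_const (RtoC 1)).
  - do 2 eexists.
    apply (jet_mult (fun v => z + v)%C (fun v => (z + v) ^ k)%C
             z (RtoC 1) (RtoC 0) (z ^ k)%C b c); [|exact IH].
    generalize (jet_plus _ _ _ _ _ _ _ _ (jet_const z) jet_id).
    apply jet_eq; ring.
Qed.

Lemma pow_ge_Bernoulli (r : R) (k : nat) :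
  0 < r < 1 -> 1 - INR k * (1 - r) <= r ^ k.
Proof.
  intros Hr; induction k as [|k IH]; [simpl; lra|].
  pose proof (pos_INR k); rewrite S_INR; simpl.
  apply Rmult_le_compat_l with (r := r) in IH; [|lra].
  assert (0 <= INR k * ((1 - r) * (1 - r))) by (apply Rmult_le_pos; nra).
  nra.
Qed.

Lemma le_1_of_pow_mult_le (k : nat) (x : R) :
  (forall r, 0 < r < 1 -> r ^ k * x <= 1) -> x <= 1.
Proof.
  intros H; apply Rnot_lt_le; intros Hx.
  pose proof (pos_INR k).
  set (d := (x - 1) / ((INR k + 1) * x)).
  assert (Hk : 0 < (INR k + 1) * x) by (apply Rmult_lt_0_compat; lra).
  assert (Hd : 0 < d) by (apply Rdiv_lt_0_compat; lra).
  assert (Hdx : d * ((INR k + 1) * x) = x - 1) by (unfold d; field; split; lra).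
  assert (Hd1 : d < 1) by nra.
  pose proof (H (1 - d) ltac:(lra)) as H1.
  pose proof (pow_ge_Bernoulli (1 - d) k ltac:(lra)) as H2.
  nra.
Qed.

(** Schwarz's lemma: on the circle of radius [r] the quotient is at most
    [1 / r^k], and [r] tends to [1]. *)
Lemma bounded_quotient_at_0 (e h : C -> C) (k : nat) :
  (forall z, in_disk z -> Cmod (e z) <= 1) ->
  (forall z, in_disk z -> smooth_at e z) ->
  (forall z, z <> RtoC 0 -> h z = (e z / z ^ k)%C) ->
  smooth_at h (RtoC 0) ->
  Cmod (h (RtoC 0)) <= 1.
Proof.
  intros He Hs Hh H0.
  apply (le_1_of_pow_mult_le k); intros r Hr.
  assert (Hrk : 0 < r ^ k) by (apply pow_lt; lra).
  assert (HM : Cmod (h (RtoC 0)) <= / r ^ k).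
  { apply (max_modulus h r); [lra| |].
    - intros z Hz; unfold in_closed_disk in Hz.
      destruct (classic (z = RtoC 0)) as [->|Hz0]; [exact H0|].
      destruct (Hs z) as (b & c & J); [unfold in_disk; lra|].
      destruct (smooth_at_Cpow k z) as (b' & c' & J').
      do 2 eexists.
      eapply jet_ext; [|rewrite Hh by assumption;
        exact (jet_div _ _ _ _ _ _ _ _ (Cpow_nz _ k Hz0) J J')].
      exists (Cmod z); split; [apply Cmod_gt_0; assumption|].
      intros v _ Hv; symmetry; apply Hh; intros Hc.
      replace v with (- z)%C in Hv.
      + rewrite Cmod_opp in Hv; lra.
      + replace v with (z + v - z)%C by ring; rewrite Hc; ring.
    - intros z Hz.
      assert (Hz0 : z <> RtoC 0) by (apply Cmod_gt_0; lra).
      rewrite Hh, Cmod_div, Cmod_pow, Hz by auto using Cpow_nz.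
      unfold Rdiv; rewrite <- (Rmult_1_l (/ r ^ k)) at 2.
      apply Rmult_le_compat_r; [left; apply Rinv_0_lt_compat; assumption|].
      apply He; unfold in_disk; lra. }
  apply Rmult_le_compat_l with (r := r ^ k) in HM; [|lra].
  rewrite Rinv_r in HM by lra; exact HM.
Qed.

Lemma jet_opp : jet (fun z => - z)%C (RtoC 0) (- (1))%C (RtoC 0).
Proof.
  exists (fun _ => RtoC 0); split; [auto with bdd|].
  exists 1; split; [lra|]; intros; ring.
Qed.

Lemma jet_comp_opp (f : C -> C) (a b c : C) :
  jet f a b c -> jet (fun z => f (- z)%C) a (- b)%C c.
Proof.
  intros H.
  assert (Hn : near0 (fun z => - z <> RtoC 0)%C).
  { exists 1; split; [lra|]; intros z Hz _ Hc; apply Hz.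
    replace z with (- - z)%C by ring; rewrite Hc; ring. }
  generalize (jet_comp _ _ _ _ _ _ _ H jet_opp Hn).
  apply jet_eq; ring.
Qed.

Lemma schwarz_coefficients (w : C -> C) :
  analytic_on_disk w -> w (RtoC 0) = RtoC 0 ->
  (forall z, in_disk z -> Cmod (w z) < 1) ->
  exists c1 c2, jet w (RtoC 0) c1 c2 /\ Cmod c1 <= 1 /\ Cmod c2 <= 1.
Proof.
  intros Hw Hw0 Hlt.
  assert (Hd0 : in_disk (RtoC 0)) by (unfold in_disk; rewrite Cmod_0; lra).
  destruct (analytic_at_pseries _ _ (Hw _ Hd0)) as (a & Ha0 & Ha).
  rewrite Hw0 in Ha0.
  assert (Ha' : near0 (fun v => Cpseries a v (w v))).
  { revert Ha; apply near0_imp; intros v _ H; rewrite Cplus_0_l in H; exact H. }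
  exists (a 1%nat), (a 2%nat); split; [|split].
  - rewrite <- Ha0; apply Cpseries_jet; assumption.
  - set (h := fun z => if excluded_middle_informative (z = RtoC 0)
                       then a 1%nat else (w z / z ^ 1)%C).
    assert (E0 : h (RtoC 0) = a 1%nat).
    { unfold h; destruct excluded_middle_informative; [reflexivity|contradiction]. }
    assert (E1 : forall z, z <> RtoC 0 -> h z = (w z / z ^ 1)%C).
    { intros z Hz; unfold h; destruct excluded_middle_informative; [contradiction|reflexivity]. }
    rewrite <- E0; apply (bounded_quotient_at_0 w h 1).
    + intros z Hz; left; auto.
    + intros z Hz; apply analytic_smooth_at; auto.
    + exact E1.
    + exists (a 2%nat), (a 3%nat); rewrite E0.
      generalize (Cpseries_jet_shift _ _ Ha0 Ha'); apply jet_ext.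
      exists 1; split; [lra|]; intros z Hz _.
      rewrite Cplus_0_l, E1, Cpow_1_r by assumption; reflexivity.
  - (* the even part of w starts with the quadratic term of w *)
    set (e := fun z => (/ (1 + 1) * (w z + w (- z)))%C).
    set (h := fun z => if excluded_middle_informative (z = RtoC 0)
                       then a 2%nat else (e z / z ^ 2)%C).
    assert (N2 : (1 + 1 <> 0)%C).
    { rewrite <- RtoC_plus; intros Hc; apply RtoC_inj in Hc; lra. }
    assert (E0 : h (RtoC 0) = a 2%nat).
    { unfold h; destruct excluded_middle_informative; [reflexivity|contradiction]. }
    assert (E1 : forall z, z <> RtoC 0 -> h z = (e z / z ^ 2)%C).
    { intros z Hz; unfold h; destruct excluded_middle_informative; [contradiction|reflexivity]. }
    rewrite <- E0; apply (bounded_quotient_at_0 e h 2).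
    + intros z Hz; unfold e.
      assert (Hz' : in_disk (- z)%C) by (unfold in_disk in *; rewrite Cmod_opp; assumption).
      specialize (Hlt _ Hz) as L1; specialize (Hlt _ Hz') as L2.
      rewrite Cmod_mult, Cmod_inv, <- RtoC_plus, Cmod_R, Rabs_pos_eq by (assumption || lra).
      pose proof (Cmod_triangle (w z) (w (- z)%C)); lra.
    + intros z Hz; unfold e.
      assert (Hz' : in_disk (- z)%C) by (unfold in_disk in *; rewrite Cmod_opp; assumption).
      destruct (analytic_smooth_at _ _ (Hw _ Hz)) as (b & c & J).
      destruct (analytic_smooth_at _ _ (Hw _ Hz')) as (b' & c' & J').
      do 2 eexists.
      generalize (jet_mult _ _ _ _ _ _ _ _ (jet_const (/ (1 + 1))%C)
                    (jet_plus _ _ _ _ _ _ _ _ J (jet_comp_opp _ _ _ _ J'))).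
      apply jet_ext; exists 1; split; [lra|]; intros v _ _.
      replace (- z + - v)%C with (- (z + v))%C by ring; reflexivity.
    + exact E1.
    + pose proof (Cpseries_shift _ _ (Cpseries_shift _ _ Ha')) as H2.
      apply Cpseries_jet in H2; cbv beta in H2.
      exists (/ (1 + 1) * (a 3%nat + - a 3%nat))%C, (a 4%nat); rewrite E0.
      generalize (jet_mult _ _ _ _ _ _ _ _ (jet_const (/ (1 + 1))%C)
                    (jet_plus _ _ _ _ _ _ _ _ H2 (jet_comp_opp _ _ _ _ H2))).
      intros J.
      apply (jet_eq _ _ _ _ (a 2%nat) (/ (1 + 1) * (a 3%nat + - a 3%nat))%C (a 4%nat))
        in J; [|field; assumption|ring|field; assumption].
      revert J; apply jet_ext; exists 1; split; [lra|]; intros z Hz _.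
      rewrite Cplus_0_l, E1 by assumption; unfold e; rewrite Ha0.
      rewrite !Cpow_S; change (z ^ 0)%C with (RtoC 1); field.
      assumption.
Qed.

(** * First coefficients of the functions involved *)

Lemma has_expansion_near0 (f : C -> C) (a : nat -> C) :
  has_expansion f a -> near0 (fun z => Cpseries a z (f z)).
Proof. intros H; exists 1; split; [lra|]; intros z _ Hz; apply H, Hz. Qed.

Lemma has_expansion_at_0 (f : C -> C) (a : nat -> C) :
  has_expansion f a -> f (RtoC 0) = a 0%nat.
Proof.
  intros H; apply Cpseries_at_0, H; unfold in_disk; rewrite Cmod_0; lra.
Qed.

Lemma Psi_2 (alpha : R) : Psi 2 alpha = 2 - 2 * alpha.
Proof. unfold Psi; simpl; field. Qed.

Lemma Psi_3 (alpha : R) : Psi 3 alpha = (2 - 2 * alpha) * (3 - 2 * alpha) / 2.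
Proof. unfold Psi; simpl; field. Qed.

Fixpoint rising (b : R) (k : nat) : R :=
  match k with O => 1 | S k => rising b k * (b + INR k) end.

Lemma is_derive_Rpower_neg (b k x : R) : x < 1 ->
  is_derive (fun x => k * Rpower (1 - x) (- b)) x (k * b * Rpower (1 - x) (- (b + 1))).
Proof.
  intros Hx.
  replace (Rpower (1 - x) (- (b + 1))) with (Rpower (1 - x) (- b) * / (1 - x)).
  - unfold Rpower; auto_derive; [lra|]. unfold Rminus; field; lra.
  - replace (- (b + 1)) with (- b + - (1)) by ring.
    rewrite Rpower_plus, Rpower_Ropp, (Rpower_Ropp _ 1), Rpower_1; lra.
Qed.

Lemma Derive_n_Rpower_neg (b : R) (k : nat) (x : R) : x < 1 ->
  Derive_n (fun x => Rpower (1 - x) (- b)) k x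
    = rising b k * Rpower (1 - x) (- (b + INR k)) /\
  ex_derive_n (fun x => Rpower (1 - x) (- b)) k x.
Proof.
  assert (HD : forall k x, x < 1 -> Derive_n (fun x => Rpower (1 - x) (- b)) k x
                 = rising b k * Rpower (1 - x) (- (b + INR k))).
  { clear k x; induction k as [|k IH]; intros x Hx.
    - simpl; rewrite Rplus_0_r; ring.
    - rewrite S_INR; simpl.
      transitivity (Derive (fun x => rising b k * Rpower (1 - x) (- (b + INR k))) x).
      + apply Derive_ext_loc.
        exists (mkposreal (1 - x) ltac:(lra)); intros y Hy.
        change (Rabs (y - x) < 1 - x) in Hy; apply Rabs_lt_between in Hy.
        apply IH; lra.
      + erewrite is_derive_unique by (apply is_derive_Rpower_neg; assumption).
        rewrite Rplus_assoc; reflexivity. }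
  intros Hx; split; [auto|].
  destruct k as [|k]; [exact I|simpl].
  eapply ex_derive_ext_loc; [|eexists; apply (is_derive_Rpower_neg (b + INR k) (rising b k) x Hx)].
  exists (mkposreal (1 - x) ltac:(lra)); intros y Hy.
  change (Rabs (y - x) < 1 - x) in Hy; apply Rabs_lt_between in Hy.
  symmetry; apply HD; lra.
Qed.

(** The factor [Rpower 2 (b + 3)] bounds [(1 - y)^(-(b + 3))] for [y < 1 / 2]. *)
Lemma Rpower_neg_taylor (b x : R) : 0 < b -> 0 < x < / 2 ->
  Rabs (Rpower (1 - x) (- b) - (1 + b * x + b * (b + 1) / 2 * (x * x)))
    <= rising b 3 * Rpower 2 (b + 3) * x ^ 3.
Proof.
  intros Hb Hx.
  destruct (Taylor_Lagrange (fun x => Rpower (1 - x) (- b)) 2 0 x) as [y [Hy E]].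
  - lra.
  - intros y Hy k _; apply Derive_n_Rpower_neg; lra.
  - rewrite E; cbv [sum_f_R0]; clear E.
    rewrite !(proj1 (Derive_n_Rpower_neg b _ 0 ltac:(lra))).
    rewrite (proj1 (Derive_n_Rpower_neg b _ y ltac:(lra))).
    replace (1 - 0) with 1 by ring.
    assert (H1 : forall p, Rpower 1 p = 1).
    { intros p; unfold Rpower; rewrite ln_1, Rmult_0_r; apply exp_0. }
    rewrite !H1.
    assert (Hr : 0 < rising b 3) by (simpl; repeat apply Rmult_lt_0_compat; lra).
    assert (HP : 0 < Rpower (1 - y) (- (b + INR 3)) <= Rpower 2 (b + 3)).
    { replace (INR 3) with 3 by (simpl; ring).
      split; [apply exp_pos|].
      apply Rnot_lt_le; intros L; apply exp_lt_inv in L.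
      assert (L' : ln (/ 2) <= ln (1 - y)) by (apply ln_le; lra).
      rewrite ln_Rinv in L' by lra; nra. }
    replace (_ - _) with (x ^ 3 / 6 * (rising b 3 * Rpower (1 - y) (- (b + INR 3)))).
    + assert (0 < x ^ 3) by (apply pow_lt; lra).
      rewrite Rabs_pos_eq.
      * rewrite Rmult_comm; apply Rmult_le_compat; try lra.
        -- apply Rmult_le_pos; lra.
        -- apply Rmult_le_compat_l; lra.
      * apply Rmult_le_pos; [lra|apply Rmult_le_pos; lra].
    + set (Q := Rpower (1 - y) _); simpl; field.
Qed.

Lemma s_fun_real (alpha x : R) : 0 < x < 1 ->
  s_fun alpha (RtoC x) = RtoC (x * Rpower (1 - x) (- (2 * (1 - alpha)))).
Proof.
  intros Hx; unfold s_fun, Crpower, Carg.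
  rewrite <- RtoC_minus, Cmod_R, Rabs_pos_eq by lra.
  replace (Im (RtoC (1 - x))) with 0 by reflexivity.
  unfold Rdiv; rewrite Rmult_0_l, atan_0, !Rmult_0_r, cos_0, sin_0.
  change (1, 0) with (RtoC 1).
  rewrite Cmult_1_r, Rpower_Ropp, RtoC_mult, RtoC_inv; [reflexivity|].
  apply Rgt_not_eq, exp_pos.
Qed.

Lemma s_fun_coefficients (alpha : R) (a : nat -> C) :
  alpha < 1 -> has_expansion (s_fun alpha) a ->
  a 1%nat = RtoC 1 /\ a 2%nat = RtoC (Psi 2 alpha) /\ a 3%nat = RtoC (Psi 3 alpha).
Proof.
  intros Ha H.
  assert (H0 : a 0%nat = RtoC 0).
  { rewrite <- (has_expansion_at_0 _ _ H); unfold s_fun, Cdiv; ring. }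
  set (b := 2 * (1 - alpha)).
  apply (jet_unique_real _ _ _ _ _ _ _ (/ 2) (rising b 3 * Rpower 2 (b + 3))
           (Cpseries_jet_shift _ _ H0 (has_expansion_near0 _ _ H))); [lra|].
  intros x Hx.
  rewrite s_fun_real by lra; fold b.
  replace (_ - _)%C with (RtoC (Rpower (1 - x) (- b)
            - (1 + b * x + b * (b + 1) / 2 * (x * x)))).
  - rewrite Cmod_R; apply Rpower_neg_taylor; [unfold b|]; lra.
  - rewrite Psi_2, Psi_3.
    replace (2 - 2 * alpha) with b by (unfold b; ring).
    replace (3 - 2 * alpha) with (b + 1) by (unfold b; ring).
    rewrite !RtoC_minus, !RtoC_plus, !RtoC_mult.
    field.
    intros Hc; apply RtoC_inj in Hc; lra.
Qed.

(** Expand [1 = (f (g w) / g w) (g w / w)]. *)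
Lemma inverse_coefficients (f g : C -> C) (a b : nat -> C) (r : R) :
  normalized_expansion f a -> univalent f -> has_expansion g b -> 0 < r ->
  (forall w, Cmod w < r -> in_disk (g w) /\ f (g w) = w) ->
  b 0%nat = RtoC 0 /\ b 1%nat = RtoC 1 /\ b 2%nat = (- a 2%nat)%C /\
  b 3%nat = (a 2%nat * a 2%nat + a 2%nat * a 2%nat - a 3%nat)%C.
Proof.
  intros (Ha0 & Ha1 & Hf) [_ Hinj] Hg Hr Hinv.
  assert (Hd0 : in_disk (RtoC 0)) by (unfold in_disk; rewrite Cmod_0; lra).
  assert (Hf0 : f (RtoC 0) = RtoC 0).
  { rewrite (has_expansion_at_0 _ _ Hf); exact Ha0. }
  assert (Hb0 : b 0%nat = RtoC 0).
  { rewrite <- (has_expansion_at_0 _ _ Hg).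
    destruct (Hinv (RtoC 0)) as [Hd E]; [rewrite Cmod_0; assumption|].
    apply Hinj; try assumption; rewrite E, Hf0; reflexivity. }
  assert (Jg := Cpseries_jet _ _ (has_expansion_near0 _ _ Hg)).
  rewrite Hb0 in Jg.
  assert (Jq := Cpseries_jet_shift _ _ Hb0 (has_expansion_near0 _ _ Hg)).
  assert (Jf := Cpseries_jet_shift _ _ Ha0 (has_expansion_near0 _ _ Hf)).
  assert (Hn : near0 (fun w => g w <> RtoC 0)).
  { exists r; split; [assumption|]; intros w Hw Hwr Hc.
    destruct (Hinv w Hwr) as [_ E]; rewrite Hc, Hf0 in E; auto. }
  assert (J := jet_mult _ _ _ _ _ _ _ _ Jq (jet_comp _ _ _ _ _ _ _ Jf Jg Hn)).
  apply (jet_ext _ (fun _ => RtoC 1)) in J; cycle 1.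
  { refine (near0_imp _ _ _ (near0_and _ _ Hn (near0_small _ Hr))).
    intros w Hw [N L]; destruct (Hinv w L) as [_ E]; rewrite E; field; auto. }
  destruct (jet_unique _ _ _ _ _ _ _ (jet_const 1) J) as (E1 & E2 & E3).
  rewrite Ha1 in *.
  assert (B1 : b 1%nat = RtoC 1) by (rewrite E1; ring).
  rewrite B1 in *.
  assert (B2 : b 2%nat = (- a 2%nat)%C).
  { transitivity (RtoC 0 - a 2%nat)%C; [rewrite E2|]; ring. }
  rewrite B2 in *.
  repeat split; try assumption.
  transitivity (b 3%nat - 0)%C; [ring|].
  rewrite E3; ring.
Qed.

Lemma RtoC_2 : RtoC 2 = (1 + 1)%C.
Proof. rewrite <- RtoC_plus; reflexivity. Qed.

Lemma class_expr_jet (lambda : R) (F : C -> C) (A : nat -> C) :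
  A 0%nat = RtoC 0 -> A 1%nat = RtoC 1 -> has_expansion F A ->
  near0 (fun z => F z <> RtoC 0 /\ C_derive F z <> RtoC 0) /\
  jet (class_expr lambda F) 1 ((1 + lambda) * A 2%nat)
    ((1 + 1) * (1 + (1 + 1) * lambda) * A 3%nat
     - (1 + (1 + 1 + 1) * lambda) * (A 2%nat * A 2%nat)).
Proof.
  intros H0 H1 HF.
  assert (HF1 := has_expansion_C_derive _ _ HF).
  assert (HF2 := has_expansion_C_derive _ _ HF1).
  assert (J0 := Cpseries_jet_shift _ _ H0 (has_expansion_near0 _ _ HF)).
  assert (J1 := Cpseries_jet _ _ (has_expansion_near0 _ _ HF1)).
  assert (J2 := jet_mult _ _ _ _ _ _ _ _ jet_id
                  (Cpseries_jet _ _ (has_expansion_near0 _ _ HF2))).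
  unfold derived_seq in J1, J2; simpl INR in J1, J2.
  rewrite H1 in J0, J1; rewrite !RtoC_plus in J1, J2.
  apply (jet_eq _ _ _ _ 1 ((1 + 1) * A 2%nat) ((1 + 1 + 1) * A 3%nat)) in J1;
    [|ring|ring|ring].
  assert (N1 : RtoC 1 <> RtoC 0) by (intros Hc; apply RtoC_inj in Hc; lra).
  assert (NF : near0 (fun z => F z <> RtoC 0)).
  { generalize (jet_neq_0 _ _ _ _ N1 J0); apply near0_imp; intros z Hz HN Hc.
    apply HN; rewrite Hc; field; assumption. }
  assert (NF' := jet_neq_0 _ _ _ _ N1 J1).
  split; [apply near0_and; assumption|].
  generalize (jet_plus _ _ _ _ _ _ _ _
    (jet_mult _ _ _ _ _ _ _ _ (jet_const (1 - lambda)%C) (jet_div _ _ _ _ _ _ _ _ N1 J1 J0))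
    (jet_mult _ _ _ _ _ _ _ _ (jet_const lambda)
      (jet_plus _ _ _ _ _ _ _ _ (jet_const 1) (jet_div _ _ _ _ _ _ _ _ N1 J2 J1)))).
  intros J; eapply jet_eq; [| | |eapply jet_ext; [|exact J]].
  - field.
  - field.
  - field.
  - generalize (near0_and _ _ NF NF'); apply near0_imp.
    intros z Hz [HN HN']; unfold class_expr; field; auto.
Qed.

Lemma Phi_comp_jet (t : R) (w : C -> C) (c1 c2 : C) :
  jet w (RtoC 0) c1 c2 ->
  jet (fun z => Phi t (w z)) 1 ((1 + 1) * t * c1)
    ((1 + 1) * t * c2 + ((1 + 1) * (1 + 1) * (t * t) - 1) * (c1 * c1)).
Proof.
  intros J.
  assert (N1 : (1 + - ((1 + 1) * t) * 0 + 0 * 0 <> 0)%C).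
  { replace (1 + - ((1 + 1) * t) * 0 + 0 * 0)%C with (RtoC 1) by ring.
    intros Hc; apply RtoC_inj in Hc; lra. }
  generalize (jet_inv _ _ _ _ N1
    (jet_plus _ _ _ _ _ _ _ _
      (jet_plus _ _ _ _ _ _ _ _ (jet_const 1)
         (jet_mult _ _ _ _ _ _ _ _ (jet_const (- ((1 + 1) * t))%C) J))
      (jet_mult _ _ _ _ _ _ _ _ J J))).
  intros J'; eapply jet_eq; [| | |eapply jet_ext; [|exact J']].
  - field; exact N1.
  - field; exact N1.
  - field; exact N1.
  - exists 1; split; [lra|]; intros z _ _; unfold Phi.
    rewrite RtoC_2, !Cpow_S; change (w z ^ 0)%C with (RtoC 1).
    unfold Cdiv; rewrite Cmult_1_l; f_equal; ring.
Qed.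

Lemma class_expr_subordinate_coefficients (lambda t : R) (F : C -> C) (A : nat -> C) :
  A 0%nat = RtoC 0 -> A 1%nat = RtoC 1 -> has_expansion F A ->
  class_expr_subordinate lambda t F ->
  exists c1 c2 : C, Cmod c1 <= 1 /\ Cmod c2 <= 1 /\
    ((1 + lambda) * A 2%nat = (1 + 1) * t * c1)%C /\
    ((1 + 1) * (1 + (1 + 1) * lambda) * A 3%nat
       - (1 + (1 + 1 + 1) * lambda) * (A 2%nat * A 2%nat)
     = (1 + 1) * t * c2 + ((1 + 1) * (1 + 1) * (t * t) - 1) * (c1 * c1))%C.
Proof.
  intros H0 H1 HF (p & Hp & _ & _ & w & Hw & Hw0 & Hlt & Hpw).
  destruct (schwarz_coefficients w Hw Hw0 Hlt) as (c1 & c2 & Jw & B1 & B2).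
  exists c1, c2; split; [assumption|]; split; [assumption|].
  destruct (class_expr_jet lambda F A H0 H1 HF) as [HN J].
  assert (J' := Phi_comp_jet t w c1 c2 Jw).
  apply (jet_ext _ (class_expr lambda F)) in J'; cycle 1.
  {
    generalize (near0_and _ _ HN (near0_small 1 Rlt_0_1)); apply near0_imp.
    intros z Hz [[N N'] L]; rewrite <- Hpw, Hp by assumption; reflexivity. }
  destruct (jet_unique _ _ _ _ _ _ _ J J') as (_ & E1 & E2); auto.
Qed.

(** * The coefficient bounds *)

Lemma coefficient_identities (l t P2 P3 a2 a3 c1 c2 d1 d2 : C) :
  t <> RtoC 0 ->
  ((1 + l) * (P2 * a2) = (1 + 1) * t * c1)%C ->
  ((1 + 1) * (1 + (1 + 1) * l) * (P3 * a3)
     - (1 + (1 + 1 + 1) * l) * (P2 * a2 * (P2 * a2))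
   = (1 + 1) * t * c2 + ((1 + 1) * (1 + 1) * (t * t) - 1) * (c1 * c1))%C ->
  ((1 + l) * (P2 * - a2) = (1 + 1) * t * d1)%C ->
  ((1 + 1) * (1 + (1 + 1) * l) * (P3 * (a2 * a2 + a2 * a2 - a3))
     - (1 + (1 + 1 + 1) * l) * (P2 * - a2 * (P2 * - a2))
   = (1 + 1) * t * d2 + ((1 + 1) * (1 + 1) * (t * t) - 1) * (d1 * d1))%C ->
  ((((1 + 1) * (1 + (1 + 1) * l) * P3
     - (l * l + (1 + 1 + 1 + 1 + 1) * l + (1 + 1)) * (P2 * P2))
    * ((1 + 1) * (1 + 1) * (t * t)) + (1 + l) * (1 + l) * (P2 * P2)) * (a2 * a2)
   = (1 + 1) * (1 + 1) * (t * t * t) * (c2 + d2))%C /\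
  ((1 + 1) * (1 + (1 + 1) * l) * P3 * (a3 - a2 * a2) = t * (c2 - d2))%C.
Proof.
  intros Ht E1 E2 E3 E4.
  assert (C1 : c1 = ((1 + l) * (P2 * a2) / ((1 + 1) * t))%C)
    by (rewrite E1; field; assumption).
  assert (D1 : d1 = (- c1)%C).
  { rewrite C1.
    transitivity ((1 + l) * (P2 * - a2) / ((1 + 1) * t))%C.
    - rewrite E3; field; assumption.
    - field; assumption. }
  rewrite D1 in *.
  set (X := ((1 + 1) * (1 + (1 + 1) * l) * (P3 * a3)
     - (1 + (1 + 1 + 1) * l) * (P2 * a2 * (P2 * a2)))%C) in *.
  set (Y := ((1 + 1) * (1 + (1 + 1) * l) * (P3 * (a2 * a2 + a2 * a2 - a3))
     - (1 + (1 + 1 + 1) * l) * (P2 * - a2 * (P2 * - a2)))%C) in *.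
  assert (C2 : c2 = ((X - ((1 + 1) * (1 + 1) * (t * t) - 1) * (c1 * c1)) / ((1 + 1) * t))%C)
    by (rewrite E2; field; assumption).
  assert (D2 : d2 = ((Y - ((1 + 1) * (1 + 1) * (t * t) - 1) * (c1 * c1)) / ((1 + 1) * t))%C)
    by (rewrite E4; field; assumption).
  rewrite C2, D2; unfold X, Y; split.
  - rewrite C1; field; assumption.
  - field; assumption.
Qed.

Lemma le_div_sqrt (m N D : R) :
  0 <= m -> 0 <= N -> 0 < D -> D * m ^ 2 <= N ^ 2 -> m <= N / sqrt D.
Proof.
  intros Hm HN HD H.
  assert (Hs : 0 < sqrt D) by (apply sqrt_lt_R0; assumption).
  apply Rmult_le_reg_r with (sqrt D); [assumption|].
  unfold Rdiv; rewrite Rmult_assoc, Rinv_l, Rmult_1_r by lra.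
  apply Rsqr_incr_0; [|apply Rmult_le_pos; lra|assumption].
  rewrite Rsqr_mult, Rsqr_sqrt by lra; unfold Rsqr; nra.
Qed.

Theorem theorem2p1 (lambda alpha t : R)
  (hlambda : 0 <= lambda <= 1) (halpha : 0 <= alpha < 1) (ht : 0 < t < 1)
  (htne : 0 < (lambda ^ 2 + 5 * lambda + 2) * (Psi 2 alpha) ^ 2
              - 2 * (1 + 2 * lambda) * Psi 3 alpha ->
          t <> (1 + lambda) * Psi 2 alpha
               / (2 * sqrt ((lambda ^ 2 + 5 * lambda + 2) * (Psi 2 alpha) ^ 2
                            - 2 * (1 + 2 * lambda) * Psi 3 alpha)))
  (f : C -> C) (a : nat -> C)
  (ha : normalized_expansion f a)
  (hf : R_Sigma lambda alpha t f) :
  Cmod (a 2%nat) <=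
    2 * t * sqrt (2 * t)
    / sqrt (Rabs ((2 * (1 + 2 * lambda) * Psi 3 alpha
                   - (lambda ^ 2 + 5 * lambda + 2) * (Psi 2 alpha) ^ 2)
                  * (4 * t ^ 2)
                  + (1 + lambda) ^ 2 * (Psi 2 alpha) ^ 2)) /\
  Cmod (a 3%nat) <=
    4 * t ^ 2 / ((1 + lambda) ^ 2 * (Psi 2 alpha) ^ 2)
    + t / ((1 + 2 * lambda) * Psi 3 alpha).
Proof.
  destruct hf as [(_ & hu & _) (g & F & G & [_ (r & Hr & Hinv)] & HF & HG & SF & SG)].
  destruct HF as (s & a' & Hs & Ha' & HF), HG as (s' & b & Hs' & Hb & HG).
  destruct ha as (Ha0 & Ha1 & Hfa).
  destruct (inverse_coefficients f g a b r (conj Ha0 (conj Ha1 Hfa)) hu Hb Hr Hinv)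
    as (Hb0 & Hb1 & Hb2 & Hb3).
  assert (Ha'0 : a' 0%nat = RtoC 0).
  { rewrite <- (has_expansion_at_0 _ _ Ha'), (has_expansion_at_0 _ _ Hfa); assumption. }
  destruct (jet_unique _ _ _ _ _ _ _
      (Cpseries_jet_shift _ _ Ha'0 (has_expansion_near0 _ _ Ha'))
      (Cpseries_jet_shift _ _ Ha0 (has_expansion_near0 _ _ Hfa)))
    as (Ha'1 & Ha'2 & Ha'3).
  destruct (s_fun_coefficients alpha s (proj2 halpha) Hs) as (S1 & S2 & S3).
  destruct (s_fun_coefficients alpha s' (proj2 halpha) Hs') as (S1' & S2' & S3').
  destruct (class_expr_subordinate_coefficients lambda t F (fun n => s n * a' n)%C
    ltac:(cbv beta; rewrite Ha'0; ring) ltac:(cbv beta; rewrite S1, Ha'1, Ha1; ring) HF SF)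
    as (c1 & c2 & Bc1 & Bc2 & E1 & E2).
  destruct (class_expr_subordinate_coefficients lambda t G (fun n => s' n * b n)%C
    ltac:(cbv beta; rewrite Hb0; ring) ltac:(cbv beta; rewrite S1', Hb1; ring) HG SG)
    as (d1 & d2 & _ & Bd2 & E3 & E4).
  rewrite S2, S3, Ha'2, Ha'3 in *; rewrite S2', S3', Hb2, Hb3 in *.
  assert (Ht0 : RtoC t <> RtoC 0) by (intros Hc; apply RtoC_inj in Hc; lra).
  destruct (coefficient_identities _ _ _ _ _ _ _ _ _ _ Ht0 E1 E2 E3 E4) as [I1 I2].
  clear E2 E3 E4.
  assert (HP2 : 0 < Psi 2 alpha) by (rewrite Psi_2; lra).
  assert (HP3 : 0 < Psi 3 alpha) by (rewrite Psi_3; nra).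
  set (P2 := Psi 2 alpha) in *; set (P3 := Psi 3 alpha) in *.
  set (D := (2 * (1 + 2 * lambda) * P3 - (lambda ^ 2 + 5 * lambda + 2) * P2 ^ 2)
             * (4 * t ^ 2) + (1 + lambda) ^ 2 * P2 ^ 2).
  assert (HD : D <> 0).
  { (* D = 0 means K (2 t)^2 = ((1 + lambda) P2)^2, which forces K > 0 and makes
       t the excluded value *)
    intros HD0.
    set (K := (lambda ^ 2 + 5 * lambda + 2) * P2 ^ 2 - 2 * (1 + 2 * lambda) * P3) in *.
    assert (HK : K * (2 * t) ^ 2 = ((1 + lambda) * P2) ^ 2)
      by (unfold D in HD0; unfold K; lra).
    assert (HQ : 0 < (1 + lambda) * P2) by (apply Rmult_lt_0_compat; lra).
    assert (HK0 : 0 < K).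
    { apply Rmult_lt_reg_r with ((2 * t) ^ 2); [apply pow_lt; lra|].
      rewrite Rmult_0_l, HK; apply pow_lt; assumption. }
    apply (htne HK0).
    assert (Hs0 : 0 < sqrt K) by (apply sqrt_lt_R0; assumption).
    rewrite <- (sqrt_pow2 ((1 + lambda) * P2)), <- HK by lra.
    rewrite sqrt_mult, sqrt_pow2 by (try apply pow2_ge_0; lra).
    field; lra. }
  split.
  - apply le_div_sqrt.
    + apply Cmod_ge_0.
    + apply Rmult_le_pos; [lra|apply sqrt_pos].
    + apply Rabs_pos_lt; exact HD.
    + rewrite Rpow_mult_distr, pow2_sqrt by lra.
      assert (I : (RtoC D * (a 2%nat * a 2%nat) = RtoC (4 * t ^ 3) * (c2 + d2))%C).
      { transitivity ((1 + 1) * (1 + 1) * (t * t * t) * (c2 + d2))%C.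
        - rewrite <- I1; apply (f_equal (fun x => x * (a 2%nat * a 2%nat))%C).
          repeat rewrite <- ?RtoC_plus, <- ?RtoC_mult, <- ?RtoC_minus.
          apply (f_equal RtoC); unfold D; ring.
        - apply (f_equal (fun x => x * (c2 + d2))%C).
          rewrite <- ?RtoC_plus, <- ?RtoC_mult; apply (f_equal RtoC); ring. }
      apply (f_equal Cmod) in I; rewrite !Cmod_mult, !Cmod_R in I.
      assert (Ht3 : 0 < t ^ 3) by (apply pow_lt; lra).
      rewrite (Rabs_pos_eq (4 * t ^ 3)) in I by lra.
      pose proof (Cmod_triangle c2 d2).
      fold D; replace (Cmod (a 2%nat) ^ 2) with (Cmod (a 2%nat) * Cmod (a 2%nat)) by ring.
      rewrite I; nra.
  - assert (B2 : Cmod (a 2%nat) ^ 2 <= 4 * t ^ 2 / ((1 + lambda) ^ 2 * P2 ^ 2)).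
    { apply (f_equal Cmod) in E1.
      rewrite <- !RtoC_plus, !Cmod_mult, !Cmod_R, !Rabs_pos_eq in E1 by lra.
      assert (HQ : 0 < (1 + lambda) ^ 2 * P2 ^ 2)
        by (apply Rmult_lt_0_compat; apply pow_lt; lra).
      apply Rmult_le_reg_r with ((1 + lambda) ^ 2 * P2 ^ 2); [assumption|].
      unfold Rdiv; rewrite Rmult_assoc, Rinv_l, Rmult_1_r by lra.
      replace (Cmod (a 2%nat) ^ 2 * ((1 + lambda) ^ 2 * P2 ^ 2))
        with (((1 + lambda) * (P2 * Cmod (a 2%nat))) ^ 2) by ring.
      rewrite E1; pose proof (Cmod_ge_0 c1).
      assert (0 < t ^ 2) by (apply pow_lt; lra).
      replace (((1 + 1) * t * Cmod c1) ^ 2) with (4 * t ^ 2 * Cmod c1 ^ 2) by ring.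
      assert (Cmod c1 ^ 2 <= 1) by (rewrite <- (pow1 2); apply pow_incr; lra).
      rewrite <- (Rmult_1_r (4 * t ^ 2)) at 2; apply Rmult_le_compat_l; lra. }
    assert (B3 : Cmod (a 3%nat - a 2%nat * a 2%nat)%C <= t / ((1 + 2 * lambda) * P3)).
    { assert (HQ : 0 < (1 + 2 * lambda) * P3) by (apply Rmult_lt_0_compat; lra).
      apply (f_equal Cmod) in I2.
      replace ((1 + 1) * (1 + (1 + 1) * lambda) * P3)%C
        with (RtoC (2 * ((1 + 2 * lambda) * P3))) in I2
        by (rewrite !RtoC_mult, RtoC_plus, RtoC_mult, RtoC_2; ring).
      rewrite !Cmod_mult, !Cmod_R, !Rabs_pos_eq in I2 by lra.
      apply Rmult_le_reg_r with ((1 + 2 * lambda) * P3); [assumption|].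
      unfold Rdiv; rewrite (Rmult_assoc t), Rinv_l, Rmult_1_r by lra.
      pose proof (Cmod_triangle c2 (- d2)) as T; rewrite Cmod_opp in T.
      change (c2 + - d2)%C with (c2 - d2)%C in T; nra. }
    replace (a 3%nat) with (a 2%nat * a 2%nat + (a 3%nat - a 2%nat * a 2%nat))%C by ring.
    eapply Rle_trans; [apply Cmod_triangle|].
    apply Rplus_le_compat; [|exact B3].
    rewrite Cmod_mult; simpl in B2; rewrite Rmult_1_r in B2; exact B2.
Qed.
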